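(* Let $\mathcal{F}$ be a holomorphic foliation of degree $d$ on $\mathbb{P}^2$ all of whose singularities are isolated and non-degenerate. Then $$\sum_{p\in\operatorname{Sing}\mathcal{F}}\operatorname{BB}(\mathcal{F},p)=(d+2)^2 .$$
   Context: $\mathbb{P}^2$ is the complex projective plane. A (singular) holomorphic foliation $\mathcal{F}$ of degree $d$ on $\mathbb{P}^2$ with isolated singularities is one induced by a homogeneous vector field $\xi=P_0\frac{\partial}{\partial x_0}+P_1\frac{\partial}{\partial x_1}+P_2\frac{\partial}{\partial x_2}$ on $\mathbb{C}^3\setminus\{0\}$ with $P_i$ homogeneous polynomials of degree $d$, which descends to a singular line field on $\mathbb{P}^2$; its singular set $\operatorname{Sing}\mathcal{F}$ (the points where $\xi$ is parallel to the radial vector field) is finite. Locally around each point, $\mathcal{F}$ is generated by a holomorphic vector field $w$ with isolated zeros, unique up to multiplication by a nowhere vanishing holomorphic function. A singular point $p$ (i.e. $w(p)=0$) is non-degenerate if the linearization $Dw(p)$ is invertible. The Baum-Bott index at a non-degenerate singular point is $\operatorname{BB}(\mathcal{F},p)=\dfrac{\operatorname{tr}(Dw(p))^2}{\det(Dw(p))}$, which does not depend on the choice of $w$ or of the local coordinates. *)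

(* Defs.v *)
(* MathComp, with real-closed, multinomials and the classical sets and reals of
   MathComp-Analysis.  The complex field is [R[i]] for [R : realType]. *)
From HB Require Import structures.
From mathcomp Require Import all_boot all_order all_algebra.
From mathcomp Require Import complex.
From mathcomp Require Import boolp classical_sets cardinality fsbigop reals.
From mathcomp Require Import mpoly.
Set Implicit Arguments.
Unset Strict Implicit.
Unset Printing Implicit Defensive.
Import Order.TTheory GRing.Theory Num.Theory.
Local Open Scope ring_scope.
Local Open Scope complex_scope.

(* The points of the projective plane are the lines through 0 in C^3. *)
Definition P2 (R : realType) : Type :=
  {L : {vspace 'rV[R[i]]_3} | \dim L == 1%N}.
HB.instance Definition _ (R : realType) := Choice.on (P2 R).

(* A nonzero vector on the line p: homogeneous coordinates of p.  All notions
   below that use it are invariant under rescaling. *)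
Definition hcoord (R : realType) (p : P2 R) : 'rV[R[i]]_3 := vpick (val p).

(* [P] stands for the vector field P_0 d/dx_0 + P_1 d/dx_1 + P_2 d/dx_2. *)
Definition eval_field (R : realType) (P : 'I_3 -> {mpoly R[i][3]})
    (x : 'rV[R[i]]_3) : 'rV[R[i]]_3 :=
  \row_i (P i).@[x 0].

(* The radial vector field takes the value x at x. *)
Definition Sing (R : realType) (P : 'I_3 -> {mpoly R[i][3]}) : set (P2 R) :=
  [set p : P2 R | forall x : 'rV[R[i]]_3,
     x \in val p -> x != 0 -> eval_field P x \in <[x]>%VS]%classic.

(* P2 being compact, the singularities are isolated exactly when there are
   finitely many of them. *)
Record foliation (R : realType) (d : nat) := Foliation {
  fol_field :> 'I_3 -> {mpoly R[i][3]};
  _ : forall i : 'I_3, fol_field i \is d.-homog;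
  _ : finite_set (Sing fol_field)
}.

(* The affine chart x_k <> 0, with coordinates u_j = x_(lift k j) / x_k;
   its inverse sends u to the point with x_k = 1 and x_(lift k j) = u_j. *)
Definition affine_coord (R : realType) (k : 'I_3) (x : 'rV[R[i]]_3) :
    'I_2 -> R[i] :=
  fun j => x 0 (lift k j) / x 0 k.

Definition chart_inv (R : realType) (k : 'I_3) : 3.-tuple {mpoly R[i][2]} :=
  [tuple (if unlift k i is Some j then 'X_j else 1) | i < 3].

(* The polynomial vector field generating the foliation in the chart x_k <> 0:
   the derivative of x_(lift k j) / x_k along P is
   (P_(lift k j) x_k - x_(lift k j) P_k) / x_k^2, which on x_k = 1 reads
   P_(lift k j) - u_j P_k.  It vanishes exactly at the singular points lying in
   the chart, so its zeros are isolated. *)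
Definition local_field (R : realType) (P : 'I_3 -> {mpoly R[i][3]}) (k : 'I_3)
    (j : 'I_2) : {mpoly R[i][2]} :=
  (P (lift k j) \mPo chart_inv R k) - 'X_j * (P k \mPo chart_inv R k).

Definition linearization (R : realType) (P : 'I_3 -> {mpoly R[i][3]})
    (k : 'I_3) (u : 'I_2 -> R[i]) : 'M[R[i]]_2 :=
  \matrix_(i < 2, j < 2) ((local_field P k i)^`M(j)).@[u].

(* The index of a standard affine chart containing p. *)
Definition chart_at (R : realType) (p : P2 R) : 'I_3 :=
  odflt ord0 [pick k | hcoord p 0 k != 0].

Definition lin_at (R : realType) (P : 'I_3 -> {mpoly R[i][3]}) (p : P2 R) :
    'M[R[i]]_2 :=
  linearization P (chart_at p) (affine_coord (chart_at p) (hcoord p)).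

Definition nondegenerate_at (R : realType) (P : 'I_3 -> {mpoly R[i][3]})
    (p : P2 R) : Prop :=
  lin_at P p \in unitmx.

Definition baum_bott (R : realType) (P : 'I_3 -> {mpoly R[i][3]}) (p : P2 R) :
    R[i] :=
  (\tr (lin_at P p)) ^+ 2 / \det (lin_at P p).

(* Main.v *)
Require Import Defs.
From HB Require Import structures.
From mathcomp Require Import all_boot all_order all_algebra.
From mathcomp Require Import perm separable ring lra zify.
From mathcomp Require Import complex.
From mathcomp Require Import boolp classical_sets cardinality fsbigop reals.
From mathcomp Require Import mpoly.
Import Order.TTheory GRing.Theory Num.Theory.
Local Open Scope ring_scope.
Local Open Scope complex_scope.

(** The theorem is an Euler-Jacobi vanishing sum in C^3.

    Let d >= 2.  Adding to P a multiple q * (x_0, x_1, x_2) of the radial field,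
    with q homogeneous of degree d - 1, changes neither the singular set nor the
    local generators, and for a suitable q the field P does not vanish at the
    singular points ([sum_baum_bott_ge2]).  Then P vanishes only at the origin
    of C^3, and the zeros of P(x) - x are the origin together with d - 1 points
    on each singular line.  At such a point x, lying on the line p, the
    derivative DP(x) has eigenvalue d on the line, and DP(x) - 1 acts on the
    quotient C^3 / C x as a generator L of the foliation linearized at p.  Hence
    det (DP(x) - 1) = (d - 1) det L and tr DP(x) - (d + 2) = tr L, so that the
    function h = (tr DP - (d + 2))^2 satisfies
      h(x) / det (DP(x) - 1) = BB(F, p) / (d - 1),
    while at the origin, where DP = 0, the same quotient is - (d + 2)^2.  Since
    h has degree 2 (d - 1) < 3 (d - 1), the quotients add up to 0 by
    [euler_jacobi], which is the formula.  This is
    [sum_baum_bott_of_multiplier_neq0]; the linear algebra is in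
    [det_quotient_mx] and [lin_at_spec].  Degrees 0 and 1 are computed directly:
    in degree 1 the sum runs over the eigenlines of a 3 x 3 matrix.

    The Euler-Jacobi theorem is proved algebraically, for n polynomials f_j of
    degree e + 1 whose leading forms P_j have only the trivial common zero and
    whose common zeros are simple.  By the Nullstellensatz
    ([projective_nullstellensatz]) there are forms a_ij with
    x_i^(N+1) = sum_j a_ij P_j.  The polynomials g_i = sum_j a_ij f_j have
    leading forms x_i^(N+1), and for such a system there is an explicit linear
    functional [mres] that kills the ideal (g) and every polynomial of degree
    less than n N.  Therefore u |-> mres (u * det a) kills the ideal (f) and
    every polynomial of degree less than n e.  Writing f_j = sum_k B_jk (x_k - v_k)
    at a zero v, one finds that det B is, modulo (f), a multiple of the
    indicator of v among the zeros, with value the Jacobian at v, and that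
    mres (det B * det a) = 1 ([mcoeff_det_eq1]).  So the functional is
    u |-> sum_v u(v) / J(v), and it vanishes in low degree. *)

Set Implicit Arguments.
Unset Strict Implicit.

(** * The weak Nullstellensatz over the complex numbers *)

Lemma subsegment_avoiding (R : realType) (s : seq R) (ab : R * R) :
  ab.1 < ab.2 -> exists cd : R * R,
    [/\ ab.1 <= cd.1, cd.1 < cd.2, cd.2 <= ab.2 &
        forall x, x \in s -> ~~ (cd.1 <= x <= cd.2)].
Proof.
elim: s ab => [|y s IH] [a b] /= ab; first by exists (a, b).
have [cd [/= acd cdd cdb Hy]] : exists cd : R * R,
    [/\ a <= cd.1, cd.1 < cd.2, cd.2 <= b & ~~ (cd.1 <= y <= cd.2)].
  have [yc|yc] := lerP y ((a + b) / 2).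
    exists ((a + 2 * b) / 3, b) => /=; split; lra.
  exists (a, (a + b) / 2) => /=; split; lra.
have [ef [/= h1 h2 h3 h4]] := IH _ cdd.
exists ef; split => //; try lra.
move=> x; rewrite inE => /orP[/eqP ->|]; last exact: h4.
by apply/negP => /andP[e1 e2]; move/negP: Hy; apply; apply/andP; split; lra.
Qed.

(** Otherwise nested segments that avoid the finite fibers one after the other
    would meet in a point that belongs to no fiber. *)
Lemma infinite_fiber (R : realType) (D : R -> nat) :
  exists k, forall s : seq R, exists2 x, x \notin s & D x = k.
Proof.
apply: contrapT => /forallNP H.
have /choice[S HS] : forall k, exists s : seq R, forall x, D x = k -> x \in s.
  move=> k; have /existsNP[s Hs] := H k; exists s => x Dx.
  by apply: contrapT => /negP xs; apply: Hs; exists x.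
have /choice[F HF] : forall q : nat * (R * R), exists cd : R * R,
    q.2.1 < q.2.2 ->
    [/\ q.2.1 <= cd.1, cd.1 < cd.2, cd.2 <= q.2.2 &
        forall x, x \in S q.1 -> ~~ (cd.1 <= x <= cd.2)].
  move=> [k ab] /=; have [/subsegment_avoiding h|_] := boolP (ab.1 < ab.2).
    by have [cd ?] := h (S k); exists cd.
  by exists ab.
(* A nested sequence of segments, the one of index m+1 avoiding fiber m. *)
pose u := fix u n := if n is m.+1 then F (m, u m) else (0, 1) : R * R.
have ult n : (u n).1 < (u n).2.
  elim: n => [|n IH] /=; first exact: ltr01.
  by case: (HF (n, u n) IH).
have umono n m : (n <= m)%N -> (u n).1 <= (u m).1 /\ (u m).2 <= (u n).2.
  elim: m => [|m IH]; first by rewrite leqn0 => /eqP ->.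
  rewrite leq_eqVlt => /orP[/eqP -> //|]; rewrite ltnS => /IH [h1 h2] /=.
  by case: (HF (m, u m) (ult m)) => /= h3 _ h4 _; split; lra.
pose A : set R := [set y | exists n, y = (u n).1]%classic.
have Aub n : ubound A (u n).2.
  move=> _ [m ->]; have [/umono[]|/ltnW/umono[]] := leqP n m.
    by move=> _; apply: le_trans; apply: ltW.
  by move=> h _; apply: (le_trans h); apply: ltW.
pose x := sup A.
have supA : has_sup A by split; [exists (u 0).1, 0%N | exists (u 0).2; apply: Aub].
have xS := HS (D x) x erefl.
case: (HF (D x, u (D x)) (ult _)) => _ _ _ /(_ x xS) /negP; apply.
apply/andP; split.
  by apply: sup_upper_bound => //; exists (D x).+1.
by apply: ge_sup; [exact: supA.1 | exact: (@Aub (D x).+1)].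
Qed.

Definition ideal (S : comPzRingType) (I : S -> Prop) : Prop :=
  [/\ I 0, forall a b, I a -> I b -> I (a + b) & forall a b, I b -> I (a * b)].

Lemma idealB (S : comPzRingType) (I : S -> Prop) a b :
  ideal I -> I a -> I b -> I (a - b).
Proof. by case=> _ D M Ia Ib; apply: D => //; rewrite -mulN1r; apply: M. Qed.

Lemma ideal_sum (S : comPzRingType) (I : S -> Prop) (T : Type) (r : seq T)
    (P : pred T) (F : T -> S) :
  ideal I -> (forall t, P t -> I (F t)) -> I (\sum_(t <- r | P t) F t).
Proof. by case=> I0 D _ H; apply: big_ind. Qed.

Definition unit_mod (S : comPzRingType) (I : S -> Prop) (a : S) : Prop :=
  exists u, I (a * u - 1).

Lemma unit_modM (S : comPzRingType) (I : S -> Prop) a b :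
  ideal I -> unit_mod I a -> unit_mod I b -> unit_mod I (a * b).
Proof.
case=> I0 D M [u Hu] [v Hv]; exists (u * v).
have -> : a * b * (u * v) - 1 = (b * v) * (a * u - 1) + (b * v - 1) by ring.
by apply: D => //; apply: M.
Qed.

Lemma horner_map_XsubC (R : realType) (n : nat) (y : {mpoly R[i][n]}) (a : R[i]) :
  (map_poly (@mpolyC n _) ('X - a%:P)).[y] = y - a%:MP.
Proof. by rewrite raddfB /= map_polyX map_polyC hornerXsubC. Qed.

(** Over an algebraically closed field a nonzero polynomial in y is a constant
    times a product of shifts y - a. *)
Lemma unit_mod_horner (R : realType) (n : nat) (I : {mpoly R[i][n]} -> Prop)
    (y : {mpoly R[i][n]}) (q : {poly R[i]}) :
  ideal I -> (forall a : R[i], unit_mod I (y - a%:MP)) -> q != 0 ->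
  unit_mod I (map_poly (@mpolyC n _) q).[y].
Proof.
move=> idI H q0; have [r ->] := closed_field_poly_normal q.
have c0 : lead_coef q != 0 by rewrite lead_coef_eq0.
rewrite map_polyZ hornerZ rmorph_prod horner_prod.
apply: unit_modM => //.
  exists ((lead_coef q)^-1)%:MP; rewrite -mpolyCM divff // mpolyC1 subrr.
  by case: idI.
elim: r => [|a r IH]; rewrite ?big_nil ?big_cons.
  by exists 1; rewrite mulr1 subrr; case: idI.
by rewrite horner_map_XsubC; apply: unit_modM idI (H a) IH.
Qed.

(** Otherwise each y - a has an inverse U a modulo I.  There are uncountably
    many a, so infinitely many of the U a have the same degree, and more of them
    than there are monomials of at most that degree are linearly dependent.
    Multiplying a dependency by the product of the corresponding y - a_j yields a nonzero
    polynomial in y that lies in I; it is also invertible modulo I, so I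
    contains 1. *)
Lemma exists_nonunit_shift (R : realType) (n : nat)
    (I : {mpoly R[i][n]} -> Prop) (y : {mpoly R[i][n]}) :
  ideal I -> ~ I 1 -> exists a : R[i], ~ unit_mod I (y - a%:MP).
Proof.
move=> idI I1; apply: contrapT => /forallNP H.
have {}H a : unit_mod I (y - a%:MP) by apply: contrapT; exact: H.
have /choice[U HU] := H.
have [k Hk] := infinite_fiber (fun r : R => msize (U r%:C)).
have many M : exists s : seq R,
    [/\ uniq s, size s = M & forall x, x \in s -> msize (U x%:C) = k].
  elim: M => [|M [s [us ss Hs]]]; first by exists [::].
  have [x xs Dx] := Hk s; exists (x :: s); split=> /=; first by rewrite xs.
    by rewrite ss.
  by move=> z; rewrite inE => /orP[/eqP -> //|]; apply: Hs.
pose N := #|{: 'X_{1..n < k}}|.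
have [s [us ss Hs]] := many N.+1.
pose a (j : 'I_N.+1) : R[i] := (nth 0 s j)%:C.
have Ha j : msize (U (a j)) = k by apply/Hs/mem_nth; rewrite ss.
have a_inj : injective a.
  move=> j l /complexI /eqP; rewrite nth_uniq ?ss // => /eqP; exact: val_inj.
pose A : 'M[R[i]]_(N.+1, N) := \matrix_(j, m) (U (a j))@_(bmnm (enum_val m)).
have [c c0 cA] : exists2 c : 'rV_N.+1, c != 0 & c *m A = 0.
  have : kermx A != 0.
    rewrite -mxrank_eq0 mxrank_ker subn_eq0 -ltnNge.
    exact: leq_ltn_trans (rank_leq_col A) _.
  move/rowV0Pn => [c cK c0]; exists c => //; exact/sub_kermxP.
have Hdep : \sum_j c 0 j *: U (a j) = 0.
  apply/mpolyP => m; rewrite mcoeff0 raddf_sum /=.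
  have [km|mk] := leqP k (mdeg m).
    rewrite big1 // => j _; rewrite mcoeffZ memN_msupp_eq0 ?mulr0 //.
    by apply: msize_mdeg_ge; rewrite Ha.
  have /matrixP/(_ 0 (enum_rank (BMultinom mk))) := cA.
  rewrite !mxE => h; apply: etrans h; apply: eq_bigr => j _.
  by rewrite mcoeffZ mxE enum_rankK.
pose L j : {poly R[i]} := \prod_(l | l != j) ('X - (a l)%:P).
pose q := \sum_j c 0 j *: L j.
have q0 : q != 0.
  have /rV0Pn[j cj] := c0.
  apply/eqP => /(congr1 (fun p => p.[a j])) /eqP; apply/negP.
  rewrite horner0 horner_sum (bigD1 j) //= big1 ?addr0.
    rewrite hornerZ mulf_neq0 // horner_prod; apply/prodf_neq0 => l lj.
    by rewrite hornerXsubC subr_eq0 (inj_eq a_inj) eq_sym.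
  move=> l lj; rewrite hornerZ horner_prod (bigD1 j) 1?eq_sym //=.
  by rewrite hornerXsubC subrr mul0r mulr0.
have [u Hu] := unit_mod_horner idI H q0.
have Iq : I (map_poly (@mpolyC n _) q).[y].
  have LE j : (map_poly (@mpolyC n _) (L j)).[y] = \prod_(l | l != j) (y - (a l)%:MP).
    rewrite rmorph_prod horner_prod; apply: eq_bigr => l _.
    exact: horner_map_XsubC.
  pose w := \prod_l (y - (a l)%:MP).
  have -> : (map_poly (@mpolyC n _) q).[y] =
     w * (\sum_j c 0 j *: U (a j)) -
     \sum_j (c 0 j *: \prod_(l | l != j) (y - (a l)%:MP)) *
       ((y - (a j)%:MP) * U (a j) - 1).
    rewrite mulr_sumr -sumrB rmorph_sum horner_sum; apply: eq_bigr => j _.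
    have -> : w = (y - (a j)%:MP) * \prod_(l | l != j) (y - (a l)%:MP).
      by rewrite /w (bigD1 j).
    rewrite /= map_polyZ hornerZ LE -!mul_mpolyC; ring.
  rewrite Hdep mulr0; apply: idealB => //; first by case: idI.
  by apply: ideal_sum => // j _; case: (idI) => _ _; apply.
apply: I1; have -> : 1 = u * (map_poly (@mpolyC n _) q).[y] -
  ((map_poly (@mpolyC n _) q).[y] * u - 1) by ring.
by apply: idealB => //; case: (idI) => _ _; apply.
Qed.

Lemma msize_sum_le (n : nat) (K : nzRingType) (T : Type) (r : seq T) (P : pred T)
    (F : T -> {mpoly K[n]}) (m : nat) :
  (forall t, P t -> (msize (F t) <= m)%N) ->
  (msize (\sum_(t <- r | P t) F t) <= m)%N.
Proof.
move=> H; apply: leq_trans (mmeasure_sum _ _ _ _) _.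
by elim/big_ind: _ => // x y; rewrite geq_max => -> ->.
Qed.

Lemma sub_meval_monomial (n : nat) (K : comNzRingType) (v : 'I_n -> K)
    (m : 'X_{1..n}) :
  exists2 b : 'I_n -> {mpoly K[n]}, forall k, (msize (b k) <= mdeg m)%N &
    'X_[m] - ('X_[m].@[v])%:MP = \sum_k b k * ('X_k - (v k)%:MP).
Proof.
move: {2}(mdeg m) (erefl (mdeg m)) => d; elim: d m => [|d IH] m dm.
  exists (fun=> 0) => [k|]; first by rewrite mmeasure0.
  move/eqP: dm; rewrite mdeg_eq0 => /eqP ->.
  rewrite mpolyX0 meval1 mpolyC1 subrr big1 // => k _; exact: mul0r.
have [k mk] : exists k, m k != 0%N.
  apply: contrapT => /forallNP H; move: dm; rewrite mdegE big1 // => k _.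
  by have /negP := H k; rewrite negbK => /eqP.
pose m' := (m - U_(k))%MM.
have mE : m = (U_(k) + m')%MM by rewrite addmC submK // lep1mP.
have dm' : mdeg m' = d by move: dm; rewrite mE mdegD mdeg1 => -[].
have [b Hb Eb] := IH _ dm'.
exists (fun l => (if l == k then 'X_[m'] else 0) + (v k)%:MP * b l) => [l|].
  apply: leq_trans (mmeasureD_le _ _ _) _; rewrite geq_max; apply/andP; split.
    by case: eqP => _; rewrite ?mmeasure0 // msizeX dm' dm.
  rewrite mul_mpolyC; apply: leq_trans (msizeZ_le _ _) _.
  by apply: leq_trans (Hb l) _; rewrite dm dm'.
under eq_bigr => l _ do rewrite mulrDl -mulrA.
rewrite big_split /= -mulr_sumr -Eb (bigD1 k) //= eqxx big1 ?addr0; last first.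
  by move=> l /negPf ->; rewrite mul0r.
rewrite {1 2}mE mpolyXD mevalM mevalXU mpolyCM; ring.
Qed.

(** The first-order Taylor (Hadamard) formula at v, with control of the degree
    of the coefficients. *)
Lemma sub_meval (n : nat) (K : comNzRingType) (v : 'I_n -> K)
    (p : {mpoly K[n]}) (d : nat) :
  (msize p <= d.+1)%N ->
  exists2 b : 'I_n -> {mpoly K[n]}, forall k, (msize (b k) <= d)%N &
    p - (p.@[v])%:MP = \sum_k b k * ('X_k - (v k)%:MP).
Proof.
move=> pd; have /choice[B HB] : forall m : 'X_{1..n}, exists b : 'I_n -> {mpoly K[n]},
   (forall k, (msize (b k) <= mdeg m)%N) /\
    'X_[m] - ('X_[m].@[v])%:MP = \sum_k b k * ('X_k - (v k)%:MP).
  by move=> m; have [b] := sub_meval_monomial v m; exists b.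
exists (fun k => \sum_(m <- msupp p) p@_m *: B m k) => [k|].
  rewrite big_seq; apply: msize_sum_le => m mp; apply: leq_trans (msizeZ_le _ _) _.
  apply: leq_trans ((HB m).1 k) _; rewrite -ltnS; apply: leq_trans pd.
  exact: msize_mdeg_lt.
have -> : (p.@[v])%:MP = \sum_(m <- msupp p) p@_m *: ('X_[m].@[v])%:MP :> {mpoly K[n]}.
  rewrite {1}[p]mpolyE [meval _ _]raddf_sum /= [LHS]raddf_sum /=.
  by apply: eq_bigr => m _; rewrite mevalZ mpolyCM mul_mpolyC.
rewrite {1}[p]mpolyE -sumrB.
under [RHS]eq_bigr => k _ do rewrite mulr_suml.
rewrite exchange_big; apply: eq_bigr => m _ /=.
under [RHS]eq_bigr => k _ do rewrite -scalerAl.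
by rewrite -scaler_sumr -(HB m).2 scalerBr.
Qed.

(** The elements x_i - v_i are added to I one at a time, the v_i being chosen by
    [exists_nonunit_shift] so that the ideal stays proper; modulo the final
    ideal every polynomial is the constant p(v). *)
Theorem weak_nullstellensatz (R : realType) (n : nat)
    (I : {mpoly R[i][n]} -> Prop) :
  ideal I -> ~ I 1 ->
  exists v : 'I_n -> R[i], forall p, I p -> p.@[v] = 0.
Proof.
move=> idI I1.
have [v [J [idJ J1 IJ HJ]]] : exists (v : 'I_n -> R[i]) (J : {mpoly R[i][n]} -> Prop),
   [/\ ideal J, ~ J 1, forall p, I p -> J p &
       forall i : 'I_n, i \in enum 'I_n -> J ('X_i - (v i)%:MP)].
  elim: (enum 'I_n) (enum_uniq 'I_n) => [|i r IH] /=; first by exists (fun=> 0), I.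
  move=> /andP[ir /IH[v [J [idJ J1 IJ HJ]]]].
  have [a Ha] := exists_nonunit_shift 'X_i idJ J1.
  have [J0 JD JM] := idJ.
  exists (fun k => if k == i then a else v k).
  exists (fun p => exists u, J (p - ('X_i - a%:MP) * u)).
  split.
  - split; first by exists 0; rewrite mulr0 subr0.
      move=> p q [u Hu] [w Hw]; exists (u + w).
      by rewrite mulrDr opprD addrACA; apply: JD.
    move=> p q [u Hu]; exists (p * u).
    by rewrite mulrCA -mulrBr; apply: JM.
  - move=> [u Hu]; apply: Ha; exists u.
    by rewrite -opprB -mulN1r; apply: JM.
  - by move=> p Ip; exists 0; rewrite mulr0 subr0; apply: IJ.
  move=> k; rewrite inE; case: eqP => [-> _|_ /= /HJ h].
    by exists 1; rewrite mulr1 subrr.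
  by exists 0; rewrite mulr0 subr0.
exists v => p Ip.
have [b _ Hb] := sub_meval v (leqnSn (msize p)).
have [J0 JD JM] := idJ.
have Jc : J (p.@[v])%:MP.
  have -> : (p.@[v])%:MP = p - (p - (p.@[v])%:MP) by ring.
  apply: idealB => //; first exact: IJ.
  by rewrite Hb; apply: ideal_sum => // k _; apply: JM; apply: HJ; rewrite mem_enum.
apply/eqP; apply: contrapT => /negP p0; apply: J1.
have -> : 1 = ((p.@[v])^-1)%:MP * (p.@[v])%:MP :> {mpoly R[i][n]}.
  by rewrite -mpolyCM mulVf.
exact: JM.
Qed.

(** * Homogeneous components, and the projective Nullstellensatz *)

Lemma pihomog_homog (n : nat) (K : nzRingType) (p : {mpoly K[n]}) (d e : nat) :
  p \is d.-homog -> pihomog mdeg e p = if e == d then p else 0.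
Proof.
move=> pd; case: eqP => [->|/eqP ed]; first exact: pihomog_dE.
by apply: pihomog_ne0 pd; rewrite eq_sym.
Qed.

Lemma pihomog_large (n : nat) (K : nzRingType) (p : {mpoly K[n]}) (e : nat) :
  (msize p <= e)%N -> pihomog mdeg e p = 0.
Proof.
move=> pe; rewrite pihomogE big_seq_cond big1 // => m /andP[mp /eqP me].
by have := leq_trans (msize_mdeg_lt mp) pe; rewrite me ltnn.
Qed.

Lemma pihomogMr (n : nat) (K : comNzRingType) (p q : {mpoly K[n]}) (d e : nat) :
  q \is d.-homog ->
  pihomog mdeg e (p * q) = if (d <= e)%N then pihomog mdeg (e - d) p * q else 0.
Proof.
move=> qd; rewrite {1}[p](@pihomog_partitionE _ _ mdeg (msize p)) //.
rewrite mulr_suml raddf_sum /=.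
have H (i : nat) : pihomog mdeg e (pihomog mdeg i p * q) =
    if e == (i + d)%N then pihomog mdeg i p * q else 0.
  by apply: pihomog_homog; apply: dhomogM => //; apply: pihomogP.
under eq_bigr => i _ do rewrite H.
case: leqP => de; last first.
  by apply: big1 => i _; case: eqP => // ei; move: de; rewrite ei ltnNge leq_addl.
have [lt|ge] := ltnP (e - d) (msize p).
  rewrite (bigD1 (Ordinal lt)) //= subnK // eqxx big1 ?addr0 // => i.
  rewrite -val_eqE /= => /eqP ide; case: eqP => // ei.
  by case: ide; rewrite ei addnK.
rewrite pihomog_large // mul0r big1 // => i _; case: eqP => // ei.
by move: ge; rewrite ei addnK leqNgt ltn_ord.
Qed.

Lemma msize_leP (n : nat) (K : nzRingType) (p : {mpoly K[n]}) (d : nat) :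
  reflect {in msupp p, forall m, (mdeg m < d)%N} (msize p <= d)%N.
Proof.
apply: (iffP idP) => [pd m mp|H]; first exact: leq_trans (msize_mdeg_lt mp) pd.
rewrite msizeE big_seq; apply: (big_ind (fun x => x <= d)%N) => // x y.
by rewrite geq_max => -> ->.
Qed.

Lemma msize_homog (n : nat) (K : nzRingType) (p : {mpoly K[n]}) (d : nat) :
  p \is d.-homog -> (msize p <= d.+1)%N.
Proof. by move=> /dhomogP pd; apply/msize_leP => m /pd ->. Qed.

Lemma mcoeff_large (n : nat) (K : nzRingType) (p : {mpoly K[n]}) (d : nat)
    (m : 'X_{1..n}) : (msize p <= d)%N -> (d <= mdeg m)%N -> p@_m = 0.
Proof.
by move=> pd dm; apply/memN_msupp_eq0/msize_mdeg_ge; apply: leq_trans dm.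
Qed.

Lemma msizeM_lt (n : nat) (K : nzRingType) (p q : {mpoly K[n]}) (a b : nat) :
  (msize p <= a)%N -> (msize q <= b.+1)%N -> (msize (p * q) <= a + b)%N.
Proof.
move=> /msize_leP pa /msize_leP qb; apply/msize_leP => m.
case/msuppM_le/allpairsP => -[m1 m2] /= [/pa m1a /qb m2b ->].
by rewrite mdegD; lia.
Qed.

Lemma msizeM_leD (n : nat) (K : nzRingType) (p q : {mpoly K[n]}) (a b : nat) :
  (msize p <= a.+1)%N -> (msize q <= b.+1)%N -> (msize (p * q) <= (a + b).+1)%N.
Proof. exact: msizeM_lt. Qed.

Lemma leading_form_decomp (n : nat) (K : nzRingType) (p : {mpoly K[n]}) (a : nat) :
  (msize p <= a.+1)%N -> (msize (p - pihomog mdeg a p) <= a)%N.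
Proof.
move=> pa; rewrite {1}[p](@pihomog_partitionE _ _ mdeg a.+1) // big_ord_recr /=.
rewrite addrK; apply: msize_sum_le => i _.
by apply: leq_trans (msize_homog (pihomogP _ _ _)) _.
Qed.

Definition in_ideal (n m : nat) (K : comNzRingType) (f : 'I_m -> {mpoly K[n]})
    (p : {mpoly K[n]}) : Prop := exists b, p = \sum_j b j * f j.

Lemma in_ideal_ideal (n m : nat) (K : comNzRingType) (f : 'I_m -> {mpoly K[n]}) :
  ideal (in_ideal f).
Proof.
split.
- by exists (fun=> 0); rewrite big1 // => j _; rewrite mul0r.
- move=> _ _ [b ->] [c ->]; exists (fun j => b j + c j); rewrite -big_split /=.
  by apply: eq_bigr => j _; rewrite mulrDl.
move=> a _ [b ->]; exists (fun j => a * b j); rewrite mulr_sumr.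
by apply: eq_bigr => j _; rewrite mulrA.
Qed.

Lemma in_ideal_gen (n m : nat) (K : comNzRingType) (f : 'I_m -> {mpoly K[n]}) j :
  in_ideal f (f j).
Proof.
exists (fun k => (k == j)%:R); rewrite (bigD1 j) //= eqxx mul1r big1 ?addr0 //.
by move=> k /negPf ->; rewrite mul0r.
Qed.

Lemma pihomog_in_ideal (n m : nat) (K : comNzRingType) (P : 'I_m -> {mpoly K[n]})
    (d e : nat) (p : {mpoly K[n]}) :
  (forall j, P j \is d.-homog) -> in_ideal P p ->
  in_ideal P (pihomog mdeg e p).
Proof.
move=> Pd [b ->].
exists (fun j => if (d <= e)%N then pihomog mdeg (e - d) (b j) else 0).
rewrite raddf_sum; apply: eq_bigr => j _ /=.
by rewrite (pihomogMr _ _ (Pd j)); case: ifP; rewrite ?mul0r.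
Qed.

(** The ideal generated by the P_j and x_i - 1 has no zero, so 1 - c (x_i - 1)
    lies in (P) for some c.  Its homogeneous components say that, modulo (P),
    the component of degree k of c is - x_i^k; it is zero for large k. *)
Lemma projective_nullstellensatz_var (R : realType) (n m d : nat)
    (P : 'I_m -> {mpoly R[i][n]}) (i : 'I_n) :
  (forall j, P j \is d.-homog) ->
  (forall v : 'I_n -> R[i], (forall j, (P j).@[v] = 0) -> v i = 0) ->
  exists N, in_ideal P ('X_i ^+ N).
Proof.
move=> Pd P0; have idP := in_ideal_ideal P; have [I0 ID IM] := idP.
pose I p := exists c, in_ideal P (p - c * ('X_i - 1)).
have idI : ideal I.
  split; first by exists 0; rewrite mul0r subr0.
    by move=> a b [u Hu] [w Hw]; exists (u + w); rewrite mulrDl opprD addrACA; apply: ID.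
  by move=> a b [u Hu]; exists (a * u); rewrite -mulrA -mulrBr; apply: IM.
have [c Hc] : I 1.
  apply: contrapT => /(weak_nullstellensatz idI)[v Hv].
  have v0 : v i = 0.
    apply: P0 => j; apply: Hv; exists 0; rewrite mul0r subr0; exact: in_ideal_gen.
  have /Hv : I ('X_i - 1) by exists 1; rewrite mul1r subrr.
  by move/eqP; rewrite mevalB mevalXU meval1 v0 sub0r oppr_eq0 oner_eq0.
have X1 : ('X_i : {mpoly R[i][n]}) \is 1.-homog by rewrite dhomogX /= mdeg1.
have key k : in_ideal P ('X_i ^+ k + pihomog mdeg k c).
  elim: k => [|k IH].
    have := pihomog_in_ideal 0 Pd Hc.
    rewrite mulrBr mulr1 !pihomogB (pihomogMr _ _ X1) /= sub0r opprK.
    by rewrite (pihomog_homog _ (dhomog1 _ _)) eqxx expr0.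
  have -> : 'X_i ^+ k.+1 + pihomog mdeg k.+1 c =
     pihomog mdeg k.+1 (1 - c * ('X_i - 1)) + 'X_i * ('X_i ^+ k + pihomog mdeg k c).
    rewrite mulrBr mulr1 !pihomogB (pihomogMr _ _ X1) /= subn1 /=.
    rewrite (pihomog_homog _ (dhomog1 _ _)) /= exprS; ring.
  by apply: ID; [apply: pihomog_in_ideal Pd Hc | apply: IM].
by exists (msize c); have := key (msize c); rewrite pihomog_large // addr0.
Qed.

Lemma projective_nullstellensatz (R : realType) (n m d : nat)
    (P : 'I_m -> {mpoly R[i][n]}) :
  (forall j, P j \is d.-homog) ->
  (forall v : 'I_n -> R[i], (forall j, (P j).@[v] = 0) -> forall i, v i = 0) ->
  exists N (a : 'M[{mpoly R[i][n]}]_(n, m)),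
    [/\ (0 < N)%N, (d <= N)%N, forall i j, a i j \is (N - d).-homog &
        forall i, 'X_i ^+ N = \sum_j a i j * P j].
Proof.
move=> Pd P0.
have /choice[N HN] : forall i, exists N, in_ideal P ('X_i ^+ N).
  by move=> i; apply: (projective_nullstellensatz_var Pd) => v /P0.
pose M := (\max_i N i + d).+1.
have /choice[b Hb] : forall i, in_ideal P ('X_i ^+ M).
  move=> i; have NM : (N i <= M)%N.
    by rewrite ltnW // ltnS (leq_trans _ (leq_addr _ _)) // leq_bigmax.
  by rewrite -(subnK NM) exprD; case: (in_ideal_ideal P) => _ _; apply.
exists M, (\matrix_(i, j) pihomog mdeg (M - d) (b i j)).
have dM : (d <= M)%N by rewrite ltnW // ltnS leq_addl.
split => // [i j|i]; first by rewrite mxE pihomogP.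
have Xi : ('X_i : {mpoly R[i][n]}) ^+ M \is M.-homog.
  by rewrite -{2}[M]mul1n; apply: dhomogMn; rewrite dhomogX /= mdeg1.
rewrite -(pihomog_dE Xi) Hb raddf_sum; apply: eq_bigr => j _ /=.
by rewrite (pihomogMr _ _ (Pd j)) dM mxE.
Qed.

(** * The residue functional of a system with pure-power leading forms *)

Lemma msize_prod_le (n : nat) (K : comNzRingType) (T : Type) (s : seq T)
    (F : T -> {mpoly K[n]}) (e : T -> nat) :
  (forall t, (msize (F t) <= (e t).+1)%N) ->
  (msize (\prod_(t <- s) F t) <= (\sum_(t <- s) e t).+1)%N.
Proof.
move=> H; elim: s => [|t s IH]; first by rewrite !big_nil msize1.
by rewrite !big_cons msizeM_leD.
Qed.

Lemma msize_exp_le (n : nat) (K : comNzRingType) (p : {mpoly K[n]}) (e k : nat) :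
  (msize p <= e.+1)%N -> (msize (p ^+ k) <= (e * k).+1)%N.
Proof.
move=> pe; elim: k => [|k IH]; first by rewrite msize1.
by rewrite exprS mulnS msizeM_leD.
Qed.

Definition mpow (n : nat) (K : comNzRingType) (r : 'I_n -> {mpoly K[n]})
    (k : 'X_{1..n}) : {mpoly K[n]} := \prod_i r i ^+ k i.

(** The exponent of x^((N+1)(k+1) - 1). *)
Definition res_mnm (n N : nat) (k : 'X_{1..n}) : 'X_{1..n} :=
  [multinom (N.+1 * k i + N)%N | i < n].

(** Partial sums of [mres]; they are constant as soon as M exceeds the degree of h,
    see [mresE]. *)
Definition mres_upto (n : nat) (K : comNzRingType) (N : nat)
    (r : 'I_n -> {mpoly K[n]}) (M : nat) (h : {mpoly K[n]}) : K :=
  \sum_(k : 'X_{1..n < M}) (h * mpow r k)@_(res_mnm N k).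

(** The coefficient of x_0^-1 ... x_(n-1)^-1 in h / (g_0 ... g_(n-1)), where
    g_i = x_i^(N+1) - r_i and each 1 / g_i is expanded at infinity as the sum of
    the r_i^k / x_i^((N+1)(k+1)).  The degree of r_i being at most N, only
    finitely many terms contribute. *)
Definition mres (n : nat) (K : comNzRingType) (N : nat)
    (r : 'I_n -> {mpoly K[n]}) (h : {mpoly K[n]}) : K :=
  mres_upto N r (msize h) h.

Lemma mpowD1 (n : nat) (K : comNzRingType) (r : 'I_n -> {mpoly K[n]})
    (k : 'X_{1..n}) (i : 'I_n) : mpow r (k + U_(i))%MM = mpow r k * r i.
Proof.
rewrite /mpow (bigD1 i) //= [in RHS](bigD1 i) //= mnmDE mnm1E eqxx addn1 exprSr.
rewrite -!mulrA; congr (_ * _); rewrite mulrC; congr (_ * _).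
by apply: eq_bigr => j /negPf ji; rewrite mnmDE mnm1E eq_sym ji addn0.
Qed.

Lemma mdeg_res_mnm (n N : nat) (k : 'X_{1..n}) :
  mdeg (res_mnm N k) = (N.+1 * mdeg k + n * N)%N.
Proof.
rewrite !mdegE; under eq_bigr => i _ do rewrite mnmE.
by rewrite big_split /= -big_distrr /= sum_nat_const card_ord.
Qed.

(** The product h * r^k has degree less than that of the monomial. *)
Lemma mres_term0 (n : nat) (K : comNzRingType) (N : nat)
    (r : 'I_n -> {mpoly K[n]}) (h : {mpoly K[n]}) (k : 'X_{1..n}) :
  (forall i, (msize (r i) <= N.+1)%N) -> (msize h <= mdeg k + n * N)%N ->
  (h * mpow r k)@_(res_mnm N k) = 0.
Proof.
move=> rN hk; case hs: (msize h) hk => [|s] hk.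
  by move/eqP: hs; rewrite msize_poly_eq0 => /eqP ->; rewrite mul0r mcoeff0.
have : (msize (mpow r k) <= (N * mdeg k).+1)%N.
  rewrite mdegE big_distrr; apply: msize_prod_le => i; exact: msize_exp_le.
move/(msizeM_leD (eq_leq hs))/mcoeff_large; apply.
by rewrite mdeg_res_mnm mulSn; lia.
Qed.

Lemma sum_bmnm_widen (n : nat) (K : nmodType) (F : 'X_{1..n} -> K) (M M' : nat) :
  (M <= M')%N -> (forall k, (M <= mdeg k)%N -> F k = 0) ->
  \sum_(k : 'X_{1..n < M'}) F k = \sum_(k : 'X_{1..n < M}) F k.
Proof.
move=> MM F0; rewrite (bigID (fun k : 'X_{1..n < M'} => mdeg k < M)%N) /=.
rewrite addrC big1 ?add0r => [|k]; last by rewrite -leqNgt => /F0.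
case: M MM F0 => [|M] MM F0.
  by rewrite !big_pred0 // => -[].
rewrite (reindex_onto (fun k : 'X_{1..n < M.+1} => BMultinom (leq_trans (bmdeg k) MM))
  (fun k => insubd bm0 (bmnm k))) /=; last first.
  by move=> k kM; apply/val_inj; rewrite /= insubdK.
apply: eq_bigl => k; rewrite bmdeg /=; apply/eqP/val_inj.
by rewrite insubdK // -topredE /= bmdeg.
Qed.

Lemma sum_bmnm_shift (n : nat) (K : nmodType) (F : 'X_{1..n} -> K) (M : nat)
    (i : 'I_n) :
  (forall k : 'X_{1..n}, k i = 0%N -> F k = 0) ->
  \sum_(k : 'X_{1..n < M.+2}) F k = \sum_(k : 'X_{1..n < M.+1}) F (k + U_(i))%MM.
Proof.
move=> F0; rewrite (bigID (fun k : 'X_{1..n < M.+2} => k i == 0%N)) /=.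
rewrite big1 ?add0r => [|k /eqP/F0 //].
have lt (k : 'X_{1..n < M.+1}) : (mdeg (k + U_(i))%MM < M.+2)%N.
  by rewrite mdegD mdeg1 addn1 ltnS bmdeg.
rewrite (reindex_onto (fun k : 'X_{1..n < M.+1} => BMultinom (lt k))
  (fun k => insubd bm0 (bmnm k - U_(i))%MM)) /=; last first.
  move=> k ki; apply/val_inj; rewrite /= insubdK ?submK // ?lep1mP //.
  have := bmdeg k; rewrite -{1}(@submK _ U_(i) k) ?lep1mP //.
  by rewrite mdegD mdeg1 addn1 ltnS.
apply: eq_bigl => k; rewrite mnmDE mnm1E eqxx addn1 /=; apply/eqP/val_inj.
by rewrite /= addmK insubdK // -topredE /= bmdeg.
Qed.

Lemma mresE (n : nat) (K : comNzRingType) (N : nat)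
    (r : 'I_n -> {mpoly K[n]}) (h : {mpoly K[n]}) (M : nat) :
  (forall i, (msize (r i) <= N.+1)%N) -> (msize h <= M)%N ->
  mres N r h = mres_upto N r M h.
Proof.
move=> rN hM; rewrite /mres /mres_upto.
rewrite (@sum_bmnm_widen _ _ (fun k => (h * mpow r k)@_(res_mnm N k)) _ _ hM) // => k hk.
by apply: mres_term0 => //; apply: leq_trans hk (leq_addr _ _).
Qed.

Lemma mresB (n : nat) (K : comNzRingType) (N : nat)
    (r : 'I_n -> {mpoly K[n]}) (g h : {mpoly K[n]}) :
  (forall i, (msize (r i) <= N.+1)%N) -> mres N r (g - h) = mres N r g - mres N r h.
Proof.
move=> rN; pose M := maxn (msize g) (msize h).
rewrite !(@mresE _ _ _ _ _ M) ?leq_maxl ?leq_maxr //.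
  rewrite /mres_upto -sumrB; apply: eq_bigr => k _.
  by rewrite mulrBl mcoeffB.
by apply: leq_trans (mmeasureD_le _ _ _) _; rewrite mmeasureN.
Qed.

Lemma mresZ (n : nat) (K : comNzRingType) (N : nat)
    (r : 'I_n -> {mpoly K[n]}) (c : K) (h : {mpoly K[n]}) :
  (forall i, (msize (r i) <= N.+1)%N) -> mres N r (c *: h) = c * mres N r h.
Proof.
move=> rN; rewrite !(@mresE _ _ _ _ _ (msize h)) ?msizeZ_le //.
rewrite /mres_upto big_distrr; apply: eq_bigr => k _ /=.
by rewrite -scalerAl mcoeffZ.
Qed.

Lemma mres0 (n : nat) (K : comNzRingType) (N : nat) (r : 'I_n -> {mpoly K[n]}) :
  (forall i, (msize (r i) <= N.+1)%N) -> mres N r 0 = 0.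
Proof. by move=> rN; rewrite -(scale0r 0) mresZ // mul0r. Qed.

Lemma mresD (n : nat) (K : comNzRingType) (N : nat)
    (r : 'I_n -> {mpoly K[n]}) (g h : {mpoly K[n]}) :
  (forall i, (msize (r i) <= N.+1)%N) -> mres N r (g + h) = mres N r g + mres N r h.
Proof.
by move=> rN; rewrite -[h in LHS]opprK mresB // -scaleN1r mresZ // mulN1r opprK.
Qed.

Lemma mres_sum (n : nat) (K : comNzRingType) (N : nat)
    (r : 'I_n -> {mpoly K[n]}) (T : Type) (s : seq T) (F : T -> {mpoly K[n]}) :
  (forall i, (msize (r i) <= N.+1)%N) ->
  mres N r (\sum_(t <- s) F t) = \sum_(t <- s) mres N r (F t).
Proof.
move=> rN; apply: (big_morph (mres N r)); last exact: mres0.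
by move=> g h; apply: mresD.
Qed.

(** Multiplying by x_i^(N+1) shifts the index k by one in direction i, as
    multiplying by r_i does, and the terms with k_i = 0 vanish because they
    are coefficients of x_i-degree N in a multiple of x_i^(N+1). *)
Lemma mres_gen (n : nat) (K : comNzRingType) (N : nat)
    (r : 'I_n -> {mpoly K[n]}) (i : 'I_n) (h : {mpoly K[n]}) :
  (forall i, (msize (r i) <= N.+1)%N) ->
  mres N r (h * ('X_i ^+ N.+1 - r i)) = 0.
Proof.
move=> rN; rewrite mulrBr mresB //; apply/eqP; rewrite subr_eq0; apply/eqP.
pose M := maxn (msize (h * 'X_i ^+ N.+1)) (msize (h * r i)).
rewrite (@mresE _ _ _ _ _ M.+2) //; last by rewrite 2?ltnW // !ltnS leq_maxl.
rewrite (@mresE _ _ _ _ _ M.+1) //; last by rewrite ltnW // ltnS leq_maxr.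
rewrite /mres_upto.
rewrite (@sum_bmnm_shift _ _
  (fun k => (h * 'X_i ^+ N.+1 * mpow r k)@_(res_mnm N k)) _ i).
  apply: eq_bigr => k _.
  have -> : h * 'X_i ^+ N.+1 * mpow r (k + U_(i))%MM =
     (h * r i * mpow r k) * 'X_[U_(i) *+ N.+1].
    rewrite mpowD1 -mpolyXn; ring.
  have -> : res_mnm N (k + U_(i))%MM = (U_(i) *+ N.+1 + res_mnm N k)%MM.
    apply/mnmP => j; rewrite !(mnmDE, mulmnE, mnm1E, mnmE).
    by case: eqP => _; lia.
  exact: mcoeffMX.
move=> k ki.
have -> : h * 'X_i ^+ N.+1 * mpow r k = h * mpow r k * 'X_[U_(i) *+ N.+1].
  rewrite -mpolyXn; ring.
apply/memN_msupp_eq0; apply/negP => /msuppM_le/allpairsP[[m1 m2]] /= [_].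
move/mem_msuppXP => <- /mnmP/(_ i); rewrite !(mnmDE, mulmnE, mnm1E, mnmE) eqxx ki.
by lia.
Qed.

(** In degree at most n N only the term k = 0 is left. *)
Lemma mres_top (n : nat) (K : comNzRingType) (N : nat)
    (r : 'I_n -> {mpoly K[n]}) (h : {mpoly K[n]}) :
  (forall i, (msize (r i) <= N.+1)%N) -> (msize h <= (n * N).+1)%N ->
  mres N r h = h@_[multinom N | i < n].
Proof.
move=> rN hN; rewrite (@mresE _ _ _ _ _ (msize h).+1) // /mres_upto.
rewrite (bigD1 bm0) //= big1 ?addr0 => [|k k0].
  rewrite /mpow big1 ?mulr1 => [|i _]; last by rewrite mnm0E expr0.
  by congr mcoeff; apply/mnmP => i; rewrite !mnmE muln0.
apply: mres_term0 => //; apply: leq_trans hN _; rewrite -addn1 addnC leq_add2r.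
by rewrite lt0n mdeg_eq0.
Qed.

(** * Determinants of matrices sending x to its powers *)

Lemma mcoeff_mulXn (n : nat) (K : comNzRingType) (p : {mpoly K[n]}) (i : 'I_n)
    (k : nat) (m : 'X_{1..n}) : (m i < k)%N -> (p * 'X_i ^+ k)@_m = 0.
Proof.
move=> mk; apply/memN_msupp_eq0; rewrite mpolyXn; apply/negP.
move=> /msuppM_le/allpairsP[[m1 m2]] /= [_ /mem_msuppXP <-] mE.
by move: mk; rewrite mE !(mnmDE, mulmnE, mnm1E) eqxx; lia.
Qed.

(** Cramer's rule. *)
Lemma adj_mul_col (S : comNzRingType) (n : nat) (M : 'M[S]_n) (x y : 'I_n -> S) :
  (forall i, \sum_k M i k * x k = y i) ->
  forall i, \det M * x i = \sum_r (\adj M) i r * y r.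
Proof.
move=> Mx i; have := mul_adj_mx M => /(congr1 (fun A => (A *m \col_k x k) i 0)).
rewrite mul_scalar_mx !mxE => <-; under eq_bigr => k _ do rewrite !mxE mulr_suml.
rewrite exchange_big; apply: eq_bigr => r _ /=.
by rewrite -Mx mulr_sumr; apply: eq_bigr => k _; rewrite mulrA.
Qed.

(** The difference of the determinants is the determinant of a matrix D whose
    product with x is zero in row i and x_j^(N+1) in the other rows.  By Cramer's
    rule x_i * det D is then a combination of the x_j^(N+1) with j <> i, so it has
    no monomial of degree N in such an x_j. *)
Lemma mcoeff_det_change_row (n N : nat) (K : comNzRingType)
    (A B : 'M[{mpoly K[n]}]_n) (i : 'I_n) :
  (forall j, \sum_k A j k * 'X_k = 'X_j ^+ N.+1) ->
  (forall j, \sum_k B j k * 'X_k = 'X_j ^+ N.+1) ->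
  (forall j, j != i -> row j A = row j B) ->
  (\det A)@_[multinom N | _ < n] = (\det B)@_[multinom N | _ < n].
Proof.
move=> HA HB AB.
(* A and B with row i replaced by the difference of their rows i. *)
pose D := \matrix_(j, k) (if j == i then A i k - B i k else A j k).
have ABe j k : j != i -> A j k = B j k.
  by move=> /AB/rowP/(_ k); rewrite !mxE.
have -> : \det A = \det B + \det D.
  rewrite -[\det B]mul1r -[\det D]mul1r; apply: (@determinant_multilinear _ _ _ _ _ i).
  - by apply/rowP => k; rewrite !mxE eqxx !mul1r addrC subrK.
  - by apply/matrixP => j k; rewrite !mxE ABe // eq_sym neq_lift.
  apply/matrixP => j k; rewrite !mxE; case: eqP => // e.
  by have := neq_lift i j; rewrite e eqxx.
rewrite mcoeffD -[RHS]addr0; congr (_ + _).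
have Dx j : \sum_k D j k * 'X_k = if j == i then 0 else 'X_j ^+ N.+1.
  under eq_bigr => k _ do rewrite mxE.
  case: (j == i); last exact: HA.
  by under eq_bigr => k _ do rewrite mulrBl; rewrite sumrB HA HB subrr.
have := adj_mul_col Dx i => /(congr1 (mcoeff (U_(i) + [multinom N | _ < n])%MM)).
rewrite mcoeffMX => ->; rewrite raddf_sum big1 // => j _ /=.
case: eqP => [_|/eqP ji]; first by rewrite mulr0 mcoeff0.
by rewrite mcoeff_mulXn // !(mnmDE, mnm1E, mnmE) eq_sym (negPf ji).
Qed.

(** Replacing the rows one at a time by x_i^N e_i does not change the
    coefficient and ends with a diagonal matrix. *)
Lemma mcoeff_det_eq1 (n N : nat) (K : comNzRingType) (T : 'M[{mpoly K[n]}]_n) :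
  (forall j, \sum_k T j k * 'X_k = 'X_j ^+ N.+1) ->
  (\det T)@_[multinom N | _ < n] = 1.
Proof.
move=> HT.
pose H (s : seq 'I_n) : 'M[{mpoly K[n]}]_n :=
  \matrix_(i, k) if i \in s then ('X_i ^+ N) *+ (i == k) else T i k.
have HH s j : \sum_k H s j k * 'X_k = 'X_j ^+ N.+1.
  under eq_bigr => k _ do rewrite mxE.
  case: (j \in s); last exact: HT.
  rewrite (bigD1 j) //= eqxx big1 ?addr0 => [|k kj]; first by rewrite -exprSr.
  by rewrite eq_sym (negPf kj) mulr0n mul0r.
have HE s : (\det T)@_[multinom N | _ < n] = (\det (H s))@_[multinom N | _ < n].
  elim: s => [|i s ->].
    by congr ((\det _)@_ _); apply/matrixP => i k; rewrite mxE in_nil.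
  apply: (@mcoeff_det_change_row _ _ _ _ _ i) => // j ji.
  by apply/rowP => k; rewrite !mxE inE (negPf ji).
rewrite (HE (enum 'I_n)).
have -> : H (enum 'I_n) = diag_mx (\row_i 'X_i ^+ N).
  by apply/matrixP => i k; rewrite !mxE mem_enum.
rewrite det_diag; under eq_bigr => i _ do rewrite mxE.
rewrite (_ : \prod_i _ = 'X_[[multinom N | _ < n]]) ?mcoeffX ?eqxx //.
by rewrite mpolyXE_id; apply: eq_bigr => i _; rewrite mnmE.
Qed.

(** * The Euler-Jacobi vanishing theorem *)

Lemma msize_det_le (n N : nat) (K : comNzRingType) (A : 'M[{mpoly K[n]}]_n) :
  (forall i j, (msize (A i j) <= N.+1)%N) -> (msize (\det A) <= (n * N).+1)%N.
Proof.
move=> AN; apply: msize_sum_le => s _; rewrite mulr_sign.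
have H : (msize (\prod_i A i (s i)) <= (n * N).+1)%N.
  have := msize_prod_le (index_enum 'I_n) (fun i => AN i (s i)).
  by rewrite sum_nat_const card_ord.
by case: ifP => _; rewrite ?mmeasureN.
Qed.

(** Components of degree N multiply, up to terms of degree below size s * N. *)
Lemma msize_prod_sub_top (n N : nat) (K : comNzRingType) (T : Type) (s : seq T)
    (F : T -> {mpoly K[n]}) :
  (forall t, (msize (F t) <= N.+1)%N) ->
  (msize (\prod_(t <- s) F t - \prod_(t <- s) pihomog mdeg N (F t))
    <= size s * N)%N.
Proof.
move=> FN; elim: s => [|t s IH]; first by rewrite !big_nil subrr mmeasure0.
rewrite !big_cons.
set A := \prod_(j <- s) F j in IH *; set B := \prod_(j <- s) pihomog _ _ _ in IH *.
have -> : F t * A - pihomog mdeg N (F t) * B =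
  (F t - pihomog mdeg N (F t)) * A + (A - B) * pihomog mdeg N (F t) by ring.
apply: leq_trans (mmeasureD_le _ _ _) _; rewrite geq_max mulSn; apply/andP; split.
  apply: msizeM_lt; first exact: leading_form_decomp.
  by have := msize_prod_le s FN; rewrite big_const_seq count_predT iter_addn_0 mulnC.
by rewrite addnC; apply: msizeM_lt => //; apply: msize_homog; apply: pihomogP.
Qed.

Lemma mcoeff_det_top (n N : nat) (K : comNzRingType) (A : 'M[{mpoly K[n]}]_n)
    (m : 'X_{1..n}) :
  (forall i j, (msize (A i j) <= N.+1)%N) -> mdeg m = (n * N)%N ->
  (\det A)@_m = (\det (map_mx (pihomog mdeg N) A))@_m.
Proof.
move=> AN mN; apply/eqP; rewrite -subr_eq0 -mcoeffB; apply/eqP.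
apply: (@mcoeff_large _ _ _ (n * N)); last by rewrite mN.
rewrite /determinant -sumrB; apply: msize_sum_le => s _.
rewrite -mulrBr mulr_sign.
have H : (msize (\prod_i A i (s i) -
    \prod_i (map_mx (pihomog mdeg N) A) i (s i)) <= n * N)%N.
  under [X in _ - X]eq_bigr => i _ do rewrite mxE.
  have := msize_prod_sub_top (index_enum 'I_n) (fun i => AN i (s i)).
  suff -> : size (index_enum 'I_n) = n by [].
  by rewrite -[index_enum _]enumT size_enum_ord.
by case: ifP => _; rewrite ?mmeasureN.
Qed.

Lemma meval_sum (n : nat) (K : comNzRingType) (v : 'I_n -> K) (T : Type)
    (s : seq T) (P : pred T) (F : T -> {mpoly K[n]}) :
  (\sum_(t <- s | P t) F t).@[v] = \sum_(t <- s | P t) (F t).@[v].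
Proof. by elim/big_rec2: _ => [|t y x _ <-]; rewrite ?meval0 ?mevalD. Qed.

Lemma mderivXU (n : nat) (K : comNzRingType) (i j : 'I_n) :
  ('X_i : {mpoly K[n]})^`M(j) = (i == j)%:R.
Proof.
rewrite mderivX mnm1E; have [->|_] := eqVneq i j; last exact: scale0r.
suff -> : (U_(j) - U_(j) = 0)%MM by rewrite mpolyX0 scale1r.
by apply/mnmP => k; rewrite mnmBE mnm0E subnn.
Qed.

Definition jacobian (n : nat) (K : comNzRingType) (f : 'I_n -> {mpoly K[n]})
    (v : 'rV[K]_n) : 'M[K]_n := \matrix_(j, k) ((f j)^`M(k)).@[v 0].

(** The derivative of b_l contributes nothing at v, where x_l - v_l vanishes. *)
Lemma meval_mderiv_factor (n : nat) (K : comNzRingType) (f : {mpoly K[n]})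
    (v : 'rV[K]_n) (b : 'I_n -> {mpoly K[n]}) (k : 'I_n) :
  f - (f.@[v 0])%:MP = \sum_l b l * ('X_l - (v 0 l)%:MP) ->
  (f^`M(k)).@[v 0] = (b k).@[v 0].
Proof.
move/(congr1 (fun p => (p^`M(k)).@[v 0])).
rewrite mderivB mderivC subr0 => ->.
rewrite (big_morph _ (mderivD k) (mderiv0 _ k)) meval_sum (bigD1 k) //= big1.
  rewrite addr0 mderivM mderivB mderivC subr0 mderivXU eqxx mulr1 mevalD mevalM mevalB mevalXU mevalC subrr mulr0.
  by rewrite add0r.
move=> l lk; rewrite /= mderivM mderivB mderivC subr0 mderivXU (negPf lk).
by rewrite mulr0 addr0 mevalM mevalB mevalXU mevalC subrr mulr0.
Qed.

(** Modulo (f), the polynomial h is the sum over v in Z of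
    h(v) / J(v) * det (B v).  The functional res kills (f), takes the value 1 at
    each det (B v), and takes the value 0 at h because of its degree. *)
Theorem euler_jacobi (R : realType) (n e : nat) (f : 'I_n -> {mpoly R[i][n]})
    (Z : seq 'rV[R[i]]_n) (h : {mpoly R[i][n]}) :
  (forall j, (msize (f j) <= e.+2)%N) ->
  (forall v : 'I_n -> R[i], (forall j, (pihomog mdeg e.+1 (f j)).@[v] = 0) ->
     forall i, v i = 0) ->
  uniq Z ->
  (forall v : 'rV[R[i]]_n, reflect (forall j, (f j).@[v 0] = 0) (v \in Z)) ->
  (forall v, v \in Z -> \det (jacobian f v) != 0) ->
  (msize h <= n * e)%N ->
  \sum_(v <- Z) h.@[v 0] / \det (jacobian f v) = 0.
Proof.
move=> fe f0 uZ HZ JZ he.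
have [[|N] [a [N0 eN aN Ha]]] := projective_nullstellensatz
  (fun j => pihomogP mdeg e.+1 (f j)) f0; first by [].
pose g i := \sum_j a i j * f j.
pose r i : {mpoly R[i][n]} := 'X_i ^+ N.+1 - g i.
have rN i : (msize (r i) <= N.+1)%N.
  have -> : r i = \sum_j - (a i j * (f j - pihomog mdeg e.+1 (f j))).
    rewrite /r Ha /g -sumrB; apply: eq_bigr => j _; ring.
  apply: msize_sum_le => j _; rewrite mmeasureN mulrC.
  rewrite -(subnKC eN); apply: msizeM_lt; first exact: leading_form_decomp.
  exact: msize_homog.
have gE i : g i = 'X_i ^+ N.+1 - r i by rewrite /r opprB addrC subrK.
(* The transformation law: the residue of f is that of g = a f, twisted by det a. *)
pose res h := mres N r (h * \det a).
have resM_f u j : res (u * f j) = 0.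
  have E : \sum_i (\adj a) j i * g i = \det a * f j.
    by rewrite (@adj_mul_col _ _ a f g) // => i; rewrite /g.
  rewrite /res mulrAC -mulrA -E mulr_sumr mres_sum //.
  by rewrite big1 // => i _; rewrite mulrA gE mres_gen.
have res_f u : in_ideal f u -> res u = 0.
  move=> [b ->]; rewrite /res mulr_suml mres_sum // big1 // => j _.
  exact: resM_f.
have idf := in_ideal_ideal f; have [If0 IfD IfM] := idf.
have /choice[B HB] : forall v : 'rV[R[i]]_n, exists B : 'M[{mpoly R[i][n]}]_n,
    (forall j k, (msize (B j k) <= e.+1)%N) /\
    forall j, f j - ((f j).@[v 0])%:MP = \sum_k B j k * ('X_k - (v 0 k)%:MP).
  move=> v; have /choice[b Hb] : forall j, exists b : 'I_n -> {mpoly R[i][n]},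
     (forall k, (msize (b k) <= e.+1)%N) /\
     f j - ((f j).@[v 0])%:MP = \sum_k b k * ('X_k - (v 0 k)%:MP).
    by move=> j; have [b b1 b2] := sub_meval (v 0) (fe j); exists b.
  exists (\matrix_(j, k) b j k); split=> [j k|j]; first by rewrite mxE (Hb j).1.
  by rewrite (Hb j).2; apply: eq_bigr => k _; rewrite mxE.
have BZ v : v \in Z -> forall j, \sum_k B v j k * ('X_k - (v 0 k)%:MP) = f j.
  by move=> /HZ fv j; rewrite -(HB v).2 fv mpolyC0 subr0.
have detB (v : 'rV[R[i]]_n) : (\det (B v)).@[v 0] = \det (jacobian f v).
  rewrite -det_map_mx; congr (\det _); apply/matrixP => j k; rewrite !mxE.
  by rewrite (meval_mderiv_factor k ((HB v).2 j)).
have detB_lin v k : v \in Z -> in_ideal f (\det (B v) * ('X_k - (v 0 k)%:MP)).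
  move=> /BZ/adj_mul_col ->; apply: ideal_sum => // j _.
  by apply: IfM; apply: in_ideal_gen.
have detB_mod v u : v \in Z ->
    in_ideal f (u * \det (B v) - (u.@[v 0]) *: \det (B v)).
  move=> vZ; have [b _ Eb] := sub_meval (v 0) (leqnSn (msize u)).
  rewrite -mul_mpolyC -mulrBl Eb mulr_suml; apply: ideal_sum => // k _.
  by rewrite -mulrA; apply: IfM; rewrite mulrC; apply: detB_lin.
have in_f0 v u : v \in Z -> in_ideal f u -> u.@[v 0] = 0.
  move=> /HZ fv [b ->]; rewrite meval_sum big1 // => j _ /=.
  by rewrite mevalM fv mulr0.
(* Up to the factor J(v), det (B v) is the indicator of v on Z. *)
have detB0 v w : v \in Z -> w \in Z -> w != v -> (\det (B v)).@[w 0] = 0.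
  move=> vZ wZ wv; have [k wk] : exists k, w 0 k != v 0 k.
    apply: contrapT => /forallNP H; move/eqP: wv; apply; apply/rowP => k.
    by have /negP := H k; rewrite negbK => /eqP.
  have := in_f0 _ _ wZ (detB_lin v k vZ).
  rewrite mevalM mevalB mevalXU mevalC => /eqP; rewrite mulf_eq0 subr_eq0.
  by rewrite (negPf wk) orbF => /eqP.
pose J v := \det (jacobian f v).
pose u := 1 - \sum_(v <- Z) (J v)^-1 *: \det (B v).
have uZ0 v : v \in Z -> u.@[v 0] = 0.
  move=> vZ; rewrite mevalB meval1 meval_sum (bigD1_seq v) //= big1_seq.
    by rewrite addr0 mevalZ detB mulVf ?subrr // JZ.
  by move=> w /andP[wv wZ] /=; rewrite mevalZ detB0 ?mulr0 // eq_sym.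
(* Were u not in (f), the ideal quotient (f) : u would have a zero v, which is in
   Z as (f) : u contains (f).  But (f) : u also contains det (B v), whose value at
   v is the nonzero J(v). *)
have uf : in_ideal f u.
  apply: contrapT => uf.
  have idI : ideal (fun w => in_ideal f (w * u)).
    split; first by rewrite mul0r.
      by move=> w w' Iw Iw'; rewrite mulrDl; apply: IfD.
    by move=> w w' Iw; rewrite -mulrA; apply: IfM.
  have [|x Hx] := weak_nullstellensatz idI; first by rewrite mul1r.
  pose v : 'rV_n := \row_k x k.
  have vx p : p.@[v 0] = p.@[x] by apply: meval_eq => k; rewrite mxE.
  have vZ : v \in Z.
    apply/HZ => j; rewrite vx; apply: Hx; rewrite mulrC; apply: IfM.
    exact: in_ideal_gen.
  have := detB_mod v u vZ; rewrite uZ0 // scale0r subr0 mulrC => /Hx.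
  by rewrite -vx detB => /eqP; apply/negP; apply: JZ.
(* Only the leading forms matter, and those of the entries of a * B v send x to the
   leading forms x_i^(N+1) of the g_i. *)
have res_detB v : v \in Z -> res (\det (B v)) = 1.
  move=> vZ; rewrite /res mulrC -det_mulmx.
  have aB i k : (msize ((a *m B v) i k) <= N.+1)%N.
    rewrite mxE; apply: msize_sum_le => j _; rewrite -(subnK eN) -addSnnS.
    by apply: msizeM_lt; [apply: msize_homog | apply: (HB v).1].
  rewrite mres_top ?msize_det_le //.
  rewrite (mcoeff_det_top aB); last first.
    by rewrite mdegE (eq_bigr (fun=> N)) ?sum_nat_const ?card_ord // => i _; rewrite mnmE.
  apply: mcoeff_det_eq1 => i.
  have X1 k : ('X_k : {mpoly R[i][n]}) \is 1.-homog by rewrite dhomogX /= mdeg1.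
  have XN : ('X_i : {mpoly R[i][n]}) ^+ N.+1 \is N.+1.-homog.
    by rewrite -{2}[N.+1]mul1n; apply: dhomogMn.
  have : \sum_k (a *m B v) i k * ('X_k - (v 0 k)%:MP) = g i.
    rewrite /g; under [RHS]eq_bigr => j _ do rewrite -(BZ v vZ) mulr_sumr.
    rewrite exchange_big; apply: eq_bigr => k _ /=; rewrite mxE mulr_suml.
    by apply: eq_bigr => j _; rewrite mulrA.
  move/(congr1 (pihomog mdeg N.+1)); rewrite gE pihomogB (pihomog_dE XN).
  rewrite (pihomog_large (rN i)) subr0 => <-; rewrite raddf_sum.
  apply: eq_bigr => k _ /=; rewrite mxE mulrBr pihomogB (pihomogMr _ _ (X1 k)) /=.
  rewrite subn1 /= [X in _ - pihomog _ _ X]mulrC mul_mpolyC linearZ /=.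
  by rewrite (pihomog_large (aB i k)) scaler0 subr0.
have resZ c w : res (c *: w) = c * res w by rewrite /res -scalerAl mresZ.
have resB w w' : res (w - w') = res w - res w' by rewrite /res mulrBl mresB.
have resh : res h = 0.
  have da : (msize (\det a) <= (n * (N - e)).+1)%N.
    by apply: msize_det_le => i j; apply: msize_homog; rewrite -subSS.
  have hN : (msize (h * \det a) <= n * N)%N.
    have -> : (n * N = n * e + n * (N - e))%N by rewrite -mulnDr subnKC.
    exact: msizeM_lt he da.
  rewrite /res (mres_top rN (leqW hN)); apply: mcoeff_large hN _.
  by rewrite mdegE (eq_bigr (fun=> N)) ?sum_nat_const ?card_ord // => i _; rewrite mnmE.
have E : h - \sum_(v <- Z) (J v)^-1 *: (h * \det (B v)) = h * u.
  rewrite /u mulrBr mulr1 mulr_sumr; congr (_ - _); apply: eq_bigr => v _.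
  by rewrite scalerAr.
have : res (h * u) = 0 by apply: res_f; apply: IfM.
rewrite -E resB resh sub0r => /eqP; rewrite oppr_eq0.
rewrite /res mulr_suml mres_sum // => /eqP S0; rewrite -[RHS]S0.
apply: eq_big_seq => v vZ.
rewrite -/(res _) resZ mulrC; congr (_ * _).
apply/esym/eqP; rewrite -subr_eq0 -[X in _ - X]mulr1 -{1}(res_detB v vZ).
by rewrite -resZ -resB; apply/eqP/res_f/detB_mod.
Qed.

(** * Derivatives of compositions and of homogeneous polynomials *)

Lemma mpoly_alg_ind (n : nat) (K : comNzRingType) (P : {mpoly K[n]} -> Prop) :
  (forall c, P c%:MP) -> (forall i, P 'X_i) ->
  (forall p q, P p -> P q -> P (p + q)) -> (forall p q, P p -> P q -> P (p * q)) ->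
  forall p, P p.
Proof.
move=> PC PX PD PM p; rewrite [p]mpolyE; apply: big_ind => //; first exact: (PC 0).
move=> m _; rewrite -mul_mpolyC; apply: (PM _ _ (PC _)); rewrite mpolyXE_id.
apply: big_ind => //; first exact: (PC 1).
move=> i _; elim: (m i) => [|j IH]; first exact: (PC 1).
by rewrite exprS; apply: PM.
Qed.

Lemma mderiv_comp (n m : nat) (K : comNzRingType) (p : {mpoly K[n]})
    (t : n.-tuple {mpoly K[m]}) (j : 'I_m) :
  (p \mPo t)^`M(j) = \sum_l (p^`M(l) \mPo t) * (tnth t l)^`M(j).
Proof.
elim/mpoly_alg_ind: p => [c|i|p q IHp IHq|p q IHp IHq].
- rewrite comp_mpolyC mderivC big1 // => l _.
  by rewrite mderivC comp_mpoly0 mul0r.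
- rewrite comp_mpolyXU -tnth_nth (bigD1 i) //= big1 ?addr0 => [|l li].
    by rewrite mderivXU eqxx comp_mpoly1 mul1r.
  by rewrite mderivXU eq_sym (negPf li) comp_mpoly0 mul0r.
- rewrite comp_mpolyD mderivD IHp IHq -big_split; apply: eq_bigr => l _ /=.
  by rewrite mderivD comp_mpolyD mulrDl.
rewrite rmorphM /= mderivM IHp IHq mulr_suml mulr_sumr -big_split.
by apply: eq_bigr => l _ /=; rewrite mderivM rmorphD !rmorphM /=; ring.
Qed.

Lemma mderiv_homog (n d : nat) (K : comNzRingType) (p : {mpoly K[n]}) (i : 'I_n) :
  p \is d.-homog -> p^`M(i) \is d.-1.-homog.
Proof.
move=> /dhomogP pd; apply/dhomogP => m; rewrite mcoeff_msupp mcoeff_deriv => pm.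
have /pd /= : (m + U_(i))%MM \in msupp p.
  by rewrite mcoeff_msupp; apply: contraNneq pm => ->; rewrite mul0rn.
by rewrite mdegD mdeg1 addn1 => <-.
Qed.

Lemma euler_identity (n d : nat) (K : comNzRingType) (p : {mpoly K[n]}) :
  p \is d.-homog -> \sum_i p^`M(i) * 'X_i = d%:R *: p.
Proof.
move=> pd; have H m : \sum_i ('X_[m] : {mpoly K[n]})^`M(i) * 'X_i = (mdeg m)%:R *: 'X_[m].
  rewrite mdegE natr_sum scaler_suml; apply: eq_bigr => i _.
  rewrite mderivX -scalerAl -mpolyXD.
  have [->|mi] := eqVneq (m i) 0%N; first by rewrite !scale0r.
  by rewrite submK // lep1mP.
rewrite [p]mpolyE scaler_sumr.
under eq_bigr => i _ do rewrite (big_morph _ (mderivD i) (mderiv0 _ i)) mulr_suml.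
rewrite exchange_big !big_seq; apply: eq_bigr => m mp /=.
under eq_bigr => i _ do rewrite mderivZ -scalerAl.
by rewrite -scaler_sumr H !scalerA mulrC (dhomog_mf pd mp).
Qed.

Lemma meval_homog_scale (n d : nat) (K : comNzRingType) (p : {mpoly K[n]})
    (c : K) (v : 'rV[K]_n) :
  p \is d.-homog -> p.@[(c *: v) 0] = c ^+ d * p.@[v 0].
Proof.
move=> pd; rewrite !mevalE mulr_sumr !big_seq; apply: eq_bigr => m mp.
rewrite mulrCA; congr (_ * _).
under eq_bigr => i _ do rewrite mxE exprMn.
by rewrite big_split /= prodrXr -mdegE (dhomog_mf pd mp).
Qed.

Lemma meval_homog0 (n d : nat) (K : comNzRingType) (p : {mpoly K[n]}) :
  p \is d.+1.-homog -> p.@[(0 : 'rV[K]_n) 0] = 0.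
Proof. by move=> pd; rewrite -(scale0r 0) (meval_homog_scale _ _ pd) expr0n mul0r. Qed.

Lemma jacobian_homog_scale (n d : nat) (K : comNzRingType)
    (P : 'I_n -> {mpoly K[n]}) (c : K) (v : 'rV[K]_n) :
  (forall j, P j \is d.-homog) ->
  jacobian P (c *: v) = c ^+ d.-1 *: jacobian P v.
Proof.
move=> Pd; apply/matrixP => j k; rewrite !mxE.
by rewrite (meval_homog_scale _ _ (mderiv_homog k (Pd j))).
Qed.

(** * Endomorphisms of a three-dimensional space on the quotient by an eigenline *)

(** When v_k = 1 and v is an eigenvector of A, this is the matrix of the
    endomorphism induced by A on K^3 / K v, in the basis of the classes of the
    e_j with j <> k: modulo v, the vector e_k is - sum_(j <> k) v_j e_j. *)
Definition quotient_mx (K : comNzRingType) (A : 'M[K]_3) (k : 'I_3) (v : 'rV[K]_3) :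
    'M[K]_2 :=
  \matrix_(i, j) (A (lift k i) (lift k j) - v 0 (lift k i) * A k (lift k j)).

Lemma det2 (K : comNzRingType) (A : 'M[K]_2) :
  \det A = A ord0 ord0 * A ord_max ord_max - A ord0 ord_max * A ord_max ord0.
Proof.
rewrite (expand_det_row _ ord0) !big_ord_recl big_ord0 /cofactor !det_mx11 !mxE /=.
have e1 : lift ord0 ord0 = ord_max :> 'I_2 by apply/val_inj.
have e0 : lift ord_max ord0 = ord0 :> 'I_2 by apply/val_inj.
by rewrite !e1 !e0 /= expr0 expr1; ring.
Qed.

Lemma det3_nat (K : comNzRingType) (f : nat -> nat -> K) :
  \det (\matrix_(i < 3, j < 3) f i j) =
    f 0%N 0%N * (f 1%N 1%N * f 2%N 2%N - f 1%N 2%N * f 2%N 1%N)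
  - f 0%N 1%N * (f 1%N 0%N * f 2%N 2%N - f 1%N 2%N * f 2%N 0%N)
  + f 0%N 2%N * (f 1%N 0%N * f 2%N 1%N - f 1%N 1%N * f 2%N 0%N).
Proof.
rewrite (expand_det_row _ ord0) !big_ord_recl big_ord0 /cofactor !det2 !mxE /=.
by rewrite !/bump /= !addn0 !addn1 /=; ring.
Qed.

Lemma mx_nat (K : Type) (n : nat) (A : 'M[K]_n.+1) :
  A = \matrix_(i, j) (fun i j : nat => A (inord i) (inord j)) i j.
Proof. by apply/matrixP => i j; rewrite mxE !inord_val. Qed.

Lemma rv_nat (K : Type) (n : nat) (v : 'rV[K]_n.+1) :
  v = \row_i (fun i : nat => v 0 (inord i)) i.
Proof. by apply/rowP => i; rewrite mxE !inord_val. Qed.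

(** The eigenvector equations express column k of A through the other columns;
    what is left is a polynomial identity in the entries, checked for each k.
    Entries are indexed by nat so that they compute. *)
Lemma det_quotient_nat (K : comNzRingType) (f : nat -> nat -> K) (g : nat -> K)
    (k : 'I_3) (mu t : K) (A := \matrix_(i < 3, j < 3) f i j : 'M[K]_3)
    (v := \row_(i < 3) g i : 'rV[K]_3) :
  v 0 k = 1 -> (forall i, \sum_j A i j * v 0 j = mu * v 0 i) ->
  \det (A - t%:M) = (mu - t) * \det (quotient_mx A k v - t%:M) /\
  \tr A = mu + \tr (quotient_mx A k v).
Proof.
pose h (i j : nat) := f i j - t *+ (i == j)%N.
have -> : A - t%:M = \matrix_(i < 3, j < 3) h i j.
  by apply/matrixP => i j; rewrite !mxE.
rewrite det3_nat {}/h det2 /mxtrace !big_ord_recl !big_ord0 {}/A {}/v !mxE /= => gk H.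
have := H (Ordinal (isT : 0 < 3)%N); rewrite !big_ord_recl big_ord0 !mxE /= !/bump /= => H0.
have := H (Ordinal (isT : 1 < 3)%N); rewrite !big_ord_recl big_ord0 !mxE /= !/bump /= => H1.
have := H (Ordinal (isT : 2 < 3)%N); rewrite !big_ord_recl big_ord0 !mxE /= !/bump /= => H2.
move: gk H0 H1 H2; rewrite /bump /= !addn0 !addn1 !addr0.
case: k H => [[|[|[|//]]] Hk] _ /= gk; rewrite gk /= ?mulr1 => H0 H1 H2.
- have -> : f 0%N 0%N = mu - f 0%N 1%N * g 1%N - f 0%N 2%N * g 2%N by rewrite -H0; ring.
  have -> : f 1%N 0%N = mu * g 1%N - f 1%N 1%N * g 1%N - f 1%N 2%N * g 2%N
    by rewrite -H1; ring.
  have -> : f 2%N 0%N = mu * g 2%N - f 2%N 1%N * g 1%N - f 2%N 2%N * g 2%N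
    by rewrite -H2; ring.
  by split; ring.
- have -> : f 0%N 1%N = mu * g 0%N - f 0%N 0%N * g 0%N - f 0%N 2%N * g 2%N
    by rewrite -H0; ring.
  have -> : f 1%N 1%N = mu - f 1%N 0%N * g 0%N - f 1%N 2%N * g 2%N by rewrite -H1; ring.
  have -> : f 2%N 1%N = mu * g 2%N - f 2%N 0%N * g 0%N - f 2%N 2%N * g 2%N
    by rewrite -H2; ring.
  by split; ring.
have -> : f 0%N 2%N = mu * g 0%N - f 0%N 0%N * g 0%N - f 0%N 1%N * g 1%N
  by rewrite -H0; ring.
have -> : f 1%N 2%N = mu * g 1%N - f 1%N 0%N * g 0%N - f 1%N 1%N * g 1%N
  by rewrite -H1; ring.
have -> : f 2%N 2%N = mu - f 2%N 0%N * g 0%N - f 2%N 1%N * g 1%N by rewrite -H2; ring.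
by split; ring.
Qed.

Lemma det_quotient_mx (K : comNzRingType) (A : 'M[K]_3) (k : 'I_3) (v : 'rV[K]_3)
    (mu t : K) :
  v 0 k = 1 -> (forall i, \sum_j A i j * v 0 j = mu * v 0 i) ->
  \det (A - t%:M) = (mu - t) * \det (quotient_mx A k v - t%:M) /\
  \tr A = mu + \tr (quotient_mx A k v).
Proof.
have := @det_quotient_nat K (fun i j : nat => A (inord i) (inord j))
  (fun i : nat => v 0 (inord i)) k mu t.
by rewrite /= -mx_nat -rv_nat.
Qed.

Lemma det2_shift (K : comNzRingType) (A : 'M[K]_2) (t : K) :
  \det (A + t%:M) = t ^+ 2 + t * \tr A + \det A.
Proof.
rewrite !det2 /mxtrace !big_ord_recl big_ord0.
have -> : lift ord0 ord0 = ord_max :> 'I_2 by apply/val_inj.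
by rewrite !mxE /= mulr1n mulr0n; ring.
Qed.

Lemma det_sub_scalar_split (K : closedFieldType) (A : 'M[K]_3) :
  exists a b c, forall t, \det (A - t%:M) = (a - t) * (b - t) * (c - t).
Proof.
have [rs Hrs] := closed_field_poly_normal (char_poly A).
have lc : lead_coef (char_poly A) = 1 by apply/monicP/char_poly_monic.
rewrite lc scale1r in Hrs.
have : size rs = 3%N.
  by have := size_prod_XsubC rs id; rewrite -Hrs size_char_poly => -[].
case: rs Hrs => [|a [|b [|c [|]]]] // Hrs _; exists a, b, c => t.
have E : (char_poly A).[t] = \det (t%:M - A).
  rewrite -horner_evalE -det_map_mx; congr (\det _); apply/matrixP => i j.
  by rewrite !mxE rmorphB rmorphMn /= /horner_eval hornerX hornerC.
have -> : A - t%:M = - 1 *: (t%:M - A) by rewrite scaleN1r opprB.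
rewrite detZ -E Hrs !big_cons big_nil !hornerE.
by rewrite /= !exprS expr0; ring.
Qed.

Lemma det0_eigenvector (K : fieldType) (n : nat) (A : 'M[K]_n) (l : K) :
  \det (A - l%:M) = 0 ->
  exists2 v : 'rV[K]_n, v != 0 & forall i, \sum_j A i j * v 0 j = l * v 0 i.
Proof.
rewrite -det_tr => /eqP/det0P[v v0 vA]; exists v => // i.
apply/eqP; rewrite -subr_eq0; apply/eqP; have /rowP/(_ i) := vA.
rewrite raddfB /= tr_scalar_mx mulmxBr mul_mx_scalar !mxE => H.
apply: etrans H; congr (_ - _).
by apply: eq_bigr => j _; rewrite mxE mulrC.
Qed.

(** The vector w - w_k v satisfies the eigenvector equation for l and has k-th
    coordinate 0, so its other coordinates give a vector killed by the invertible
    matrix. *)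
Lemma eigenvector_unique (K : fieldType) (A : 'M[K]_3) (k : 'I_3) (v w : 'rV[K]_3)
    (l : K) :
  v 0 k = 1 -> (forall i, \sum_j A i j * v 0 j = l * v 0 i) ->
  (forall i, \sum_j A i j * w 0 j = l * w 0 i) ->
  quotient_mx A k v - l%:M \in unitmx -> w = w 0 k *: v.
Proof.
move=> vk Av Aw U; apply/eqP; rewrite -subr_eq0; apply/eqP.
pose u := w - w 0 k *: v; rewrite -/u.
have uE j : u 0 j = w 0 j - w 0 k * v 0 j by rewrite !mxE.
have uk : u 0 k = 0 by rewrite uE vk mulr1 subrr.
have Au i : \sum_j A i j * u 0 j = l * u 0 i.
  under eq_bigr => j _ do rewrite uE mulrBr mulrCA.
  by rewrite sumrB -mulr_sumr Av Aw uE; ring.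
move: u uk Au {uE} => u uk Au.
have Al r : \sum_j A r (lift k j) * u 0 (lift k j) = l * u 0 r.
  by rewrite -Au (bigD1_ord k) //= uk mulr0 add0r.
pose x : 'cV[K]_2 := \col_j u 0 (lift k j).
have lx : (quotient_mx A k v - l%:M) *m x = 0.
  rewrite mulmxBl mul_scalar_mx; apply/colP => i; rewrite !mxE.
  under eq_bigr => j _ do rewrite !mxE mulrBl -mulrA.
  by rewrite sumrB -mulr_sumr !Al uk mulr0 mulr0 subr0 subrr.
have x0 : x = 0 by rewrite -[x](mulKmx U) lx mulmx0.
apply/rowP => i; rewrite mxE; case: (unliftP k i) => [j ->|-> //].
by have /colP/(_ j) := x0; rewrite !mxE.
Qed.

(** * Singular points and their linearizations *)

Lemma hcoord_neq0 (R : realType) (p : P2 R) : hcoord p != 0.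
Proof. by rewrite vpick0 -dimv_eq0 (eqP (valP p)). Qed.

Lemma chart_at_neq0 (R : realType) (p : P2 R) : hcoord p 0 (chart_at p) != 0.
Proof.
rewrite /chart_at; case: pickP => [//|H].
by have /rV0Pn[k] := hcoord_neq0 p; have /= -> := H k.
Qed.

(** The point of the line p on which the coordinate defining the chart is 1, so
    that its other coordinates are the affine ones. *)
Definition rep (R : realType) (p : P2 R) : 'rV[R[i]]_3 :=
  (hcoord p 0 (chart_at p))^-1 *: hcoord p.

Lemma rep_chart (R : realType) (p : P2 R) : rep p 0 (chart_at p) = 1.
Proof. by rewrite mxE mulVf // chart_at_neq0. Qed.

Lemma scale_rep_chart (R : realType) (a : R[i]) (p : P2 R) :
  (a *: rep p) 0 (chart_at p) = a.
Proof. by rewrite mxE rep_chart mulr1. Qed.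

Lemma rep_neq0 (R : realType) (p : P2 R) : rep p != 0.
Proof.
apply/eqP => /rowP/(_ (chart_at p)) /eqP.
by rewrite rep_chart mxE oner_eq0.
Qed.

Lemma mem_rep (R : realType) (p : P2 R) : rep p \in val p.
Proof. by rewrite memvZ // memv_pick. Qed.

Lemma P2_line (R : realType) (p : P2 R) (x : 'rV[R[i]]_3) :
  x \in val p -> x != 0 -> val p = <[x]>%VS.
Proof.
move=> xp x0; apply/esym/eqP; rewrite eqEdim -memvE xp /=.
by rewrite (eqP (valP p)) dim_vline x0.
Qed.

Lemma mem_P2E (R : realType) (p : P2 R) (x : 'rV[R[i]]_3) :
  x \in val p -> x = x 0 (chart_at p) *: rep p.
Proof.
rewrite (P2_line (mem_rep p) (rep_neq0 p)) => /vlineP[c ->].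
by rewrite mxE rep_chart mulr1.
Qed.

Lemma P2_eq (R : realType) (p q : P2 R) (x : 'rV[R[i]]_3) :
  x != 0 -> x \in val p -> x \in val q -> p = q.
Proof. by move=> x0 xp xq; apply/val_inj; rewrite (P2_line xp) // (P2_line xq). Qed.

Lemma exists_line (R : realType) (x : 'rV[R[i]]_3) :
  x != 0 -> exists p : P2 R, x \in val p.
Proof.
move=> x0; have H : \dim <[x]>%VS == 1%N by rewrite dim_vline x0.
by exists (exist _ <[x]>%VS H); rewrite memv_line.
Qed.

(** The scalar by which P multiplies [rep p] when p is singular. *)
Definition multiplier (R : realType) (P : 'I_3 -> {mpoly R[i][3]}) (p : P2 R) : R[i] :=
  (P (chart_at p)).@[rep p 0].

Lemma SingE (R : realType) (d : nat) (P : 'I_3 -> {mpoly R[i][3]}) (p : P2 R) :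
  (forall j, P j \is d.-homog) ->
  Sing P p <-> forall i, (P i).@[rep p 0] = multiplier P p * rep p 0 i.
Proof.
move=> Pd; split=> [/(_ _ (mem_rep p) (rep_neq0 p)) /vlineP[c Hc] i|H x xp x0].
  have Ec j : (P j).@[rep p 0] = c * rep p 0 j.
    by have /rowP/(_ j) := Hc; rewrite !mxE.
  by rewrite /multiplier !Ec rep_chart mulr1.
have xE := mem_P2E xp; set c := x 0 (chart_at p) in xE.
have c0 : c != 0 by apply: contraNneq x0 => e; rewrite xE e scale0r.
apply/vlineP; exists (c ^+ d * multiplier P p / c); apply/rowP => i.
rewrite !mxE xE (meval_homog_scale _ _ (Pd i)) H !mxE.
by rewrite -!mulrA mulKf.
Qed.

(** A nonzero x with P(x) parallel to x spans a singular line; homogeneity relates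
    the factor at x to the one at [rep p]. *)
Lemma Sing_line (R : realType) (P : 'I_3 -> {mpoly R[i][3]}) (p : P2 R)
    (x : 'rV[R[i]]_3) (c : R[i]) (d : nat) :
  (forall j, P j \is d.-homog) ->
  x \in val p -> x != 0 -> (forall i, (P i).@[x 0] = c * x 0 i) ->
  exists a, [/\ Sing P p, a != 0, x = a *: rep p & a ^+ d * multiplier P p = c * a].
Proof.
move=> Pd xp x0 Px; have xE := mem_P2E xp; set a := x 0 (chart_at p) in xE *.
have a0 : a != 0 by apply: contraNneq x0 => e; rewrite xE e scale0r.
have H i : a ^+ d * (P i).@[rep p 0] = c * a * rep p 0 i.
  by rewrite -(meval_homog_scale _ _ (Pd i)) -xE Px {1}xE mxE mulrA.
have m : a ^+ d * multiplier P p = c * a by rewrite H rep_chart mulr1.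
exists a; split => //; apply/(SingE _ Pd) => i; apply: (mulfI (expf_neq0 d a0)).
by rewrite H mulrA m.
Qed.

Lemma meval_chart_inv (R : realType) (p : {mpoly R[i][3]}) (k : 'I_3)
    (v : 'rV[R[i]]_3) :
  v 0 k = 1 -> (p \mPo chart_inv R k).@[fun j => v 0 (lift k j)] = p.@[v 0].
Proof.
move=> vk; rewrite comp_mpoly_meval; apply: meval_eq => i.
rewrite tnth_mktuple; case: unliftP => [j ->|->]; first by rewrite mevalXU.
by rewrite meval1 vk.
Qed.

Lemma mderiv_chart_inv (R : realType) (p : {mpoly R[i][3]}) (k : 'I_3) (j : 'I_2) :
  (p \mPo chart_inv R k)^`M(j) = p^`M(lift k j) \mPo chart_inv R k.
Proof.
rewrite mderiv_comp (bigD1 (lift k j)) //= big1 ?addr0 => [|l lj].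
  by rewrite tnth_mktuple liftK mderivXU eqxx mulr1.
rewrite tnth_mktuple; case: unliftP lj => [i ->|_ _].
  by rewrite (inj_eq lift_inj) => ij; rewrite mderivXU (negPf ij) mulr0.
by rewrite -mpolyC1 mderivC mulr0.
Qed.

Lemma mderiv_local_field (R : realType) (P : 'I_3 -> {mpoly R[i][3]}) (k : 'I_3)
    (i j : 'I_2) :
  (local_field P k i)^`M(j) =
    ((P (lift k i))^`M(lift k j) \mPo chart_inv R k)
    - ((i == j)%:R *: (P k \mPo chart_inv R k)
       + 'X_i * ((P k)^`M(lift k j) \mPo chart_inv R k)).
Proof.
rewrite -2!mderiv_chart_inv /local_field.
move: (_ \mPo _) (_ \mPo _) => f g.
rewrite mderivB mderivM mderivXU; congr (_ - (_ + _)).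
by case: (i == j); rewrite ?mul1r ?scale1r ?mul0r ?scale0r.
Qed.

(** The chart identifies the tangent space of the plane at p with the quotient
    of C^3 by p. *)
Lemma lin_atE (R : realType) (P : 'I_3 -> {mpoly R[i][3]}) (p : P2 R) :
  lin_at P p = quotient_mx (jacobian P (rep p)) (chart_at p) (rep p)
    - (multiplier P p)%:M.
Proof.
apply/matrixP => i j; rewrite /lin_at /linearization mxE mderiv_local_field.
set u := affine_coord _ _.
have E : u =1 (fun j => rep p 0 (lift (chart_at p) j)).
  by move=> l; rewrite /u /affine_coord /rep mxE mulrC.
move: u E => u E.
have M (f g h : {mpoly R[i][2]}) c f' g' h' : f.@[u] = f' -> g.@[u] = g' ->
    h.@[u] = h' -> (f - (c *: g + 'X_i * h)).@[u] = f' - (c * g' + u i * h').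
  by move=> <- <- <-; rewrite mevalB mevalD mevalZ mevalM mevalXU.
have Ev q : (q \mPo chart_inv R (chart_at p)).@[u] = q.@[rep p 0].
  by rewrite (meval_eq _ E) (meval_chart_inv _ (rep_chart p)).
rewrite (M _ _ _ _ _ _ _ (Ev _) (Ev _) (Ev _)) E !mxE /multiplier.
move: (meval _ _) (meval _ _) (meval _ _) => a b c.
by rewrite -[in RHS]mulr_natl; ring.
Qed.

(** By Euler's identity v = [rep p] is an eigenvector of the derivative of P at v,
    for the eigenvalue d * lam, and the linearization is the derivative minus
    lam on the quotient by v. *)
Lemma lin_at_spec (R : realType) (d : nat) (P : 'I_3 -> {mpoly R[i][3]}) (p : P2 R)
    (A := jacobian P (rep p)) (lam := multiplier P p) :
  (forall j, P j \is d.-homog) -> Sing P p ->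
  \tr A = \tr (lin_at P p) + (d%:R + 2) * lam /\
  forall t, \det (A - t%:M) =
    (d%:R * lam - t) * \det (lin_at P p + (lam - t)%:M).
Proof.
move=> Pd pS; have /(SingE _ Pd) Hp := pS.
have HA i : \sum_j A i j * rep p 0 j = (d%:R * lam) * rep p 0 i.
  rewrite -mulrA -Hp -mevalZ -(euler_identity (Pd i)) meval_sum.
  by apply: eq_bigr => j _; rewrite mxE mevalM mevalXU.
have H t := @det_quotient_mx _ A (chart_at p) (rep p) (d%:R * lam) t (rep_chart p) HA.
rewrite lin_atE -/lam -/A; split=> [|t].
  rewrite (H 0).2 raddfB /= mxtrace_scalar -mulr_natl; ring.
rewrite (H t).1; congr (_ * \det _); rewrite -addrA; congr (_ + _).
by rewrite raddfB /= addKr.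
Qed.

(** * Degree at least two *)

(** The derivative vanishes only at 0, which is not a root, so the roots are
    simple. *)
Lemma roots_Xn_sub (R : realType) (n : nat) (c : R[i]) :
  c != 0 -> exists rs : seq R[i],
    [/\ uniq rs, size rs = n.+1 & forall x, (x \in rs) = (x ^+ n.+1 == c)].
Proof.
move=> c0; have [rs Hrs] := closed_field_poly_normal ('X ^+ n.+1 - c%:P : {poly R[i]}).
have lc : lead_coef ('X ^+ n.+1 - c%:P : {poly R[i]}) = 1.
  by apply/monicP/monicXnsubC.
rewrite lc scale1r in Hrs; exists rs; split.
- rewrite -separable_prod_XsubC -Hrs; rewrite unlock; apply/Pdiv.ClosedField.coprimepP => x.
  rewrite !rootE derivB derivXn derivC subr0 !hornerE /= subr_eq0 => /eqP xc.
  rewrite hornerMn hornerXn mulrn_eq0 /= expf_eq0; apply/negP => /andP[_ /eqP x0].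
  by move/negP: c0; rewrite -xc x0 expr0n.
- by have := size_prod_XsubC rs id; rewrite -Hrs size_XnsubC // => -[].
by move=> x; rewrite -root_prod_XsubC -Hrs rootE !hornerE /= subr_eq0.
Qed.

(** The Euler-Jacobi theorem applied to P(x) - x and (tr DP - (d + 2))^2, for
    d = e + 2. *)
Lemma sum_baum_bott_of_multiplier_neq0 (R : realType) (e : nat)
    (P : 'I_3 -> {mpoly R[i][3]}) (s : seq (P2 R)) :
  (forall j, P j \is e.+2.-homog) -> uniq s -> (forall p, p \in s <-> Sing P p) ->
  (forall p, p \in s -> nondegenerate_at P p) ->
  (forall p, p \in s -> multiplier P p != 0) ->
  \sum_(p <- s) baum_bott P p = (e.+2%:R + 2) ^+ 2.
Proof.
move=> Pd us sS nd lam0.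
pose f j : {mpoly R[i][3]} := P j - 'X_j.
have X1 j : ('X_j : {mpoly R[i][3]}) \is 1.-homog by rewrite dhomogX /= mdeg1.
have fe j : (msize (f j) <= e.+3)%N.
  apply: leq_trans (mmeasureD_le _ _ _) _; rewrite mmeasureN geq_max msize_homog //=.
  exact: leq_trans (msize_homog (X1 j)) _.
have ftop j : pihomog mdeg e.+2 (f j) = P j.
  by rewrite pihomogB (pihomog_dE (Pd j)) (pihomog_homog _ (X1 j)) subr0.
(* A nonzero common zero of the P_j would span a singular line of multiplier 0. *)
have f0 (v : 'I_3 -> R[i]) : (forall j, (pihomog mdeg e.+2 (f j)).@[v] = 0) ->
    forall i, v i = 0.
  move=> Pv; pose x : 'rV[R[i]]_3 := \row_i v i.
  have [x0 i|x0] := eqVneq x 0; first by have /rowP/(_ i) := x0; rewrite !mxE.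
  have [p xp] := exists_line x0.
  have Px i : (P i).@[x 0] = 0 * x 0 i.
    rewrite mul0r -[RHS](Pv i) ftop; apply: meval_eq => k; rewrite mxE.
    by [].
  have [a [/sS ps a0 _ /eqP]] := Sing_line Pd xp x0 Px.
  by rewrite mul0r mulf_eq0 expf_eq0 /= (negPf a0) (negPf (lam0 p ps)).
have /choice[rts Hrts] : forall p, exists rs : seq R[i], p \in s ->
    [/\ uniq rs, size rs = e.+1 & forall x, (x \in rs) = (x ^+ e.+1 == (multiplier P p)^-1)].
  move=> p; have [ps|] := boolP (p \in s); last by exists [::].
  by have [rs Hrs] := roots_Xn_sub e (invr_neq0 (lam0 p ps)); exists rs.
(* The zeros of P(x) - x: a * rep p is one exactly when a^(d-1) * multiplier = 1. *)
pose Z := 0 :: [seq a *: rep p | p <- s, a <- rts p].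
have root_neq0 p a : p \in s -> a \in rts p -> a != 0.
  move=> ps; have [_ _ ->] := Hrts p ps; apply: contraTneq => ->.
  by rewrite expr0n /= eq_sym invr_eq0 lam0.
have uZ : uniq Z.
  rewrite /= ; apply/andP; split.
    apply/negP => /allpairsPdep[p [a [ps ap]]] /eqP.
    by rewrite eq_sym scaler_eq0 (negPf (root_neq0 _ _ ps ap)) (negPf (rep_neq0 p)).
  apply: allpairs_uniq_dep => // [p ps|]; first by have [] := Hrts p ps.
  move=> _ _ /allpairsPdep[p [a [ps ap ->]]] /allpairsPdep[q [b [qs bq ->]]] /= E.
  have pq : p = q.
    apply: (@P2_eq _ _ _ (a *: rep p)); last by rewrite E memvZ ?mem_rep.
      by rewrite scaler_eq0 negb_or (root_neq0 p) // rep_neq0.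
    by rewrite memvZ ?mem_rep.
  move: E; rewrite -pq => /rowP/(_ (chart_at p)).
  by rewrite !scale_rep_chart => ->.
have fv (v : 'rV_3) j : (f j).@[v 0] = (P j).@[v 0] - v 0 j.
  by rewrite mevalB mevalXU.
have HZ (v : 'rV_3) : reflect (forall j, (f j).@[v 0] = 0) (v \in Z).
  rewrite inE; apply: (iffP orP) => [[/eqP -> j|]|H].
  - by rewrite fv (meval_homog0 (Pd j)) mxE subrr.
  - move=> /allpairsPdep[p [a [ps ap ->]]] j; rewrite fv.
    have /(SingE _ Pd) Hp := (sS p).1 ps.
    rewrite (meval_homog_scale _ _ (Pd j)) Hp [X in _ - X]mxE exprSr.
    have [_ _ Ha] := Hrts p ps; move: ap; rewrite Ha => /eqP ->.
    by rewrite mulrACA mulVf ?lam0 // mul1r subrr.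
  have [v0|v0] := eqVneq v 0; [by left | right].
  have [p vp] := exists_line v0.
  have Pv i : (P i).@[v 0] = 1 * v 0 i.
    by apply/eqP; rewrite mul1r -subr_eq0 -fv H.
  have [a [/sS ps a0 -> aE]] := Sing_line Pd vp v0 Pv.
  apply/allpairsPdep; exists p, a; split => //.
  have [_ _ ->] := Hrts p ps; apply/eqP/(mulIf (lam0 p ps)).
  by rewrite mulVf ?lam0 //; apply: (mulfI a0); rewrite mulrA -exprS aE mul1r mulr1.
have Jf (v : 'rV_3) : jacobian f v = jacobian P v - 1%:M.
  apply/matrixP => j k; rewrite !mxE mderivB mevalB mderivXU.
  by case: (j == k); rewrite ?meval1 ?meval0.
have J0 : jacobian P 0 = 0.
  by rewrite -(scale0r 0) (jacobian_homog_scale _ _ Pd) /= expr0n scale0r.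
have Ja p a : p \in s -> a \in rts p ->
    jacobian P (a *: rep p) = (multiplier P p)^-1 *: jacobian P (rep p).
  move=> ps; have [_ _ ->] := Hrts p ps => /eqP <-.
  by rewrite (jacobian_homog_scale _ _ Pd).
have detJ p a : p \in s -> a \in rts p -> \det (jacobian f (a *: rep p)) =
    (multiplier P p) ^- 2 * (e.+1%:R * \det (lin_at P p)).
  move=> ps ap; have l0 := lam0 p ps.
  have -> : jacobian f (a *: rep p) =
      (multiplier P p)^-1 *: (jacobian P (rep p) - (multiplier P p)%:M).
    by rewrite Jf Ja // scalerBr scale_scalar_mx mulVf.
  have [_ E] := lin_at_spec Pd ((sS p).1 ps).
  rewrite detZ E subrr raddf0 addr0; move: (\det _) (multiplier P p) l0 => D l l0.
  by rewrite -[in e.+2%:R]addn1 natrD; field.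
have trJ p a : p \in s -> a \in rts p ->
    \tr (jacobian P (a *: rep p)) - (e.+2%:R + 2) =
    (multiplier P p)^-1 * \tr (lin_at P p).
  move=> ps ap; have l0 := lam0 p ps; rewrite Ja // mxtraceZ.
  have [-> _] := lin_at_spec Pd ((sS p).1 ps).
  by rewrite mulrDr mulrCA mulVf // mulr1 addrK.
have dl p : p \in s -> \det (lin_at P p) != 0.
  by move=> /nd; rewrite /nondegenerate_at unitmxE unitfE.
pose h : {mpoly R[i][3]} := (\sum_i (P i)^`M(i) - (e.+2%:R + 2)%:MP) ^+ 2.
have hv (v : 'rV_3) : h.@[v 0] = (\tr (jacobian P v) - (e.+2%:R + 2)) ^+ 2.
  rewrite /h rmorphXn /= mevalB mevalC meval_sum; congr ((_ - _) ^+ 2).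
  by apply: eq_bigr => i _; rewrite mxE.
have he : (msize h <= 3 * e.+1)%N.
  have H : (msize (\sum_i (P i)^`M(i) - (e.+2%:R + 2)%:MP) <= e.+2)%N.
    apply: leq_trans (mmeasureD_le _ _ _) _; rewrite mmeasureN geq_max.
    rewrite msize_sum_le => [|i _]; last exact: msize_homog (mderiv_homog i (Pd i)).
    by rewrite mmeasureC; case: eqP.
  by apply: leq_trans (msize_exp_le 2 H) _; lia.
have detJ0 : \det (jacobian f 0) = -1.
  by rewrite Jf J0 sub0r -scaleN1r detZ det1 mulr1 -signr_odd expr1.
have JZ v : v \in Z -> \det (jacobian f v) != 0.
  rewrite inE => /orP[/eqP ->|/allpairsPdep[p [a [ps ap ->]]]].
    by rewrite detJ0 oppr_eq0 oner_eq0.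
  by rewrite detJ // !mulf_neq0 ?invr_neq0 ?expf_neq0 ?lam0 ?dl // pnatr_eq0.
have /eqP := euler_jacobi fe f0 uZ HZ JZ he.
rewrite big_cons big_allpairs_dep /= hv detJ0 J0 mxtrace0 sub0r sqrrN invrN1 mulrN1 addrC subr_eq0 => /eqP <-.
rewrite !big_seq; apply: eq_bigr => p ps.
rewrite (eq_big_seq (fun=> baum_bott P p / e.+1%:R)) => [|a ap].
  have [_ srts _] := Hrts p ps.
  rewrite big_const_seq count_predT srts iter_addr_0 -[RHS]mulr_natr mulfVK //.
  by rewrite pnatr_eq0.
rewrite hv trJ // detJ // /baum_bott; have := dl p ps; have := lam0 p ps.
move: (\det _) (\tr _) (multiplier P p) => D t l l0 D0.
have e0 : (e.+1%:R : R[i]) != 0 by rewrite pnatr_eq0.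
move: e0; move: (e.+1%:R) => E E0.
by field; rewrite E0 D0 l0.
Qed.

Definition add_radial (R : realType) (P : 'I_3 -> {mpoly R[i][3]})
    (q : {mpoly R[i][3]}) : 'I_3 -> {mpoly R[i][3]} := fun j => P j + q * 'X_j.

(** The local generators are the derivatives along P of ratios of coordinates,
    which the radial field kills. *)
Lemma lin_at_add_radial (R : realType) (P : 'I_3 -> {mpoly R[i][3]})
    (q : {mpoly R[i][3]}) (p : P2 R) :
  lin_at (add_radial P q) p = lin_at P p.
Proof.
suff E k i : local_field (add_radial P q) k i = local_field P k i.
  rewrite /lin_at; move: (chart_at p) (affine_coord _ _) => k u.
  by apply/matrixP => i j; rewrite [LHS]mxE [RHS]mxE (E k i).
have Ek : ('X_k : {mpoly R[i][3]}) \mPo chart_inv R k = 1.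
  by rewrite comp_mpolyXU -tnth_nth tnth_mktuple unlift_none.
have El : ('X_(lift k i) : {mpoly R[i][3]}) \mPo chart_inv R k = 'X_i.
  by rewrite comp_mpolyXU -tnth_nth tnth_mktuple liftK.
rewrite /local_field /add_radial !comp_mpolyD !rmorphM /= Ek El.
move: (_ \mPo _) (_ \mPo _) (_ \mPo _) => a b c; ring.
Qed.

Lemma Sing_add_radial (R : realType) (P : 'I_3 -> {mpoly R[i][3]})
    (q : {mpoly R[i][3]}) (p : P2 R) :
  Sing (add_radial P q) p <-> Sing P p.
Proof.
have E x : eval_field (add_radial P q) x = eval_field P x + q.@[x 0] *: x.
  by apply/rowP => i; rewrite !mxE /add_radial mevalD mevalM mevalXU.
have Z (x : 'rV[R[i]]_3) : q.@[x 0] *: x \in <[x]>%VS by rewrite memvZ // memv_line.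
by split=> H x xp x0; have := H x xp x0; rewrite E rpredDr.
Qed.

Lemma multiplier_add_radial (R : realType) (P : 'I_3 -> {mpoly R[i][3]})
    (q : {mpoly R[i][3]}) (p : P2 R) :
  multiplier (add_radial P q) p = multiplier P p + q.@[rep p 0].
Proof.
by rewrite /multiplier /add_radial mevalD mevalM mevalXU rep_chart mulr1.
Qed.

Lemma common_nonroot (K : closedFieldType) (T : eqType) (s : seq T)
    (f : T -> {poly K}) :
  (forall t, t \in s -> f t != 0) -> exists x, forall t, t \in s -> ~~ root (f t) x.
Proof.
move=> f0; have : \prod_(t <- s) f t != 0 by rewrite prodf_seq_neq0; apply/allP => t /f0.
move=> /closed_nonrootP[x]; rewrite rootE horner_prod => nx; exists x => t ts.
by move: nx; rewrite prodf_seq_neq0 => /allP /(_ t ts).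
Qed.

(** Among the forms x_0 + t x_1 + t^2 x_2 only finitely many t are excluded. *)
Lemma exists_linear_form_neq0 (R : realType) (s : seq 'rV[R[i]]_3) :
  (forall v, v \in s -> v != 0) ->
  exists l : {mpoly R[i][3]}, l \is 1.-homog /\ forall v, v \in s -> l.@[v 0] != 0.
Proof.
move=> s0.
(* The value at v of x_0 + t x_1 + t^2 x_2, as a polynomial in t. *)
pose f (v : 'rV[R[i]]_3) : {poly R[i]} := \poly_(j < 3) v 0 (inord j).
have [v vs|x Hx] := @common_nonroot _ _ s f.
  apply: contraNneq (s0 v vs) => /polyP f0; apply/eqP/rowP => i.
  by have := f0 i; rewrite coef_poly ltn_ord inord_val coef0 mxE.
exists (\sum_(j < 3) (x ^+ j) *: 'X_j); split.
  by apply: rpred_sum => j _; apply: rpredZ; rewrite dhomogX /= mdeg1.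
move=> v /Hx; rewrite rootE horner_poly meval_sum; congr (_ != 0).
by apply: eq_bigr => j _; rewrite mevalZ mevalXU inord_val mulrC.
Qed.

(** The radial multiple c * l^(d-1) is added, for a linear form l that vanishes at
    no singular point and a constant c that makes every multiplier nonzero. *)
Lemma sum_baum_bott_ge2 (R : realType) (e : nat)
    (P : 'I_3 -> {mpoly R[i][3]}) (s : seq (P2 R)) :
  (forall j, P j \is e.+2.-homog) -> uniq s -> (forall p, p \in s <-> Sing P p) ->
  (forall p, p \in s -> nondegenerate_at P p) ->
  \sum_(p <- s) baum_bott P p = (e.+2%:R + 2) ^+ 2.
Proof.
move=> Pd us sS nd.
have [v /mapP[p _ ->]|l [l1 Hl]] := @exists_linear_form_neq0 R [seq rep p | p <- s].
  exact: rep_neq0.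
pose f p := (multiplier P p)%:P + ((l.@[rep p 0]) ^+ e.+1)%:P * 'X : {poly R[i]}.
have [p ps|c Hc] := @common_nonroot _ _ s f.
  apply/eqP => /polyP/(_ 1%N) /eqP.
  rewrite coefD coefC coefMX coefC coef0 add0r; apply/negP/expf_neq0/Hl.
  exact: map_f.
pose q := c *: l ^+ e.+1.
have qd : q \is e.+1.-homog.
  by apply: rpredZ; have := dhomogMn e.+1 l1; rewrite mul1n.
have H : \sum_(p <- s) baum_bott (add_radial P q) p = (e.+2%:R + 2) ^+ 2.
  apply: sum_baum_bott_of_multiplier_neq0 => [j||p|p ps|p ps].
  - have Xj : ('X_j : {mpoly R[i][3]}) \is 1.-homog by rewrite dhomogX /= mdeg1.
    by apply: (rpredD (Pd j)); have := dhomogM qd Xj; rewrite addn1.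
  - exact: us.
  - by rewrite Sing_add_radial.
  - by rewrite /nondegenerate_at lin_at_add_radial; apply: nd.
  rewrite multiplier_add_radial /q mevalZ rmorphXn /=.
  by have := Hc p ps; rewrite rootE !hornerE mulrC.
by rewrite -H; apply: eq_bigr => p _; rewrite /baum_bott lin_at_add_radial.
Qed.

(** * Degrees zero and one *)

Lemma homog0E (n : nat) (K : nzRingType) (p : {mpoly K[n]}) :
  p \is 0.-homog -> p = (p@_0%MM)%:MP.
Proof. by move=> /msize_homog; apply: msize1_polyC. Qed.

(** The only singular point is the line spanned by the constant P, where the
    linearization is scalar, of Baum-Bott index 4. *)
Lemma sum_baum_bott_deg0 (R : realType) (P : 'I_3 -> {mpoly R[i][3]})
    (s : seq (P2 R)) :
  (forall j, P j \is 0.-homog) -> uniq s -> (forall p, p \in s <-> Sing P p) ->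
  (forall p, p \in s -> nondegenerate_at P p) ->
  \sum_(p <- s) baum_bott P p = (0%:R + 2) ^+ 2.
Proof.
move=> Pd us sS nd; pose c : 'rV[R[i]]_3 := \row_j (P j)@_0%MM.
have Pc (v : 'rV[R[i]]_3) j : (P j).@[v 0] = c 0 j.
  by rewrite [in LHS](homog0E (Pd j)) mevalC mxE.
have lin p : lin_at P p = (- multiplier P p)%:M.
  rewrite lin_atE raddfN -[RHS]add0r; congr (_ + _); apply/matrixP => i j.
  have J0 k l : jacobian P (rep p) k l = 0.
    by rewrite mxE (homog0E (Pd k)) mderivC meval0.
  by rewrite [LHS]mxE [RHS]mxE !J0 mulr0 subr0.
have lam0 p : p \in s -> multiplier P p != 0.
  move=> /nd; rewrite /nondegenerate_at lin unitmxE det_scalar unitfE.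
  by rewrite expf_eq0 /= oppr_eq0.
have cE p : p \in s -> c = multiplier P p *: rep p.
  move=> /sS/(SingE _ Pd) Hp; apply/rowP => j.
  by rewrite -(Pc (rep p)) Hp [RHS]mxE.
have [p0 p0s] : exists p, p \in s.
  have [c0|c0] := eqVneq c 0; last first.
    have [p cp] := exists_line c0; exists p; apply/sS.
    have Pcc i : (P i).@[c 0] = 1 * c 0 i by rewrite Pc mul1r.
    by have [a []] := Sing_line Pd cp c0 Pcc.
  have n0 : const_mx 1 != 0 :> 'rV[R[i]]_3.
    by apply/eqP => /rowP/(_ 0) /eqP; rewrite !mxE oner_eq0.
  have [p _] := exists_line n0; exists p; apply/sS => x _ _.
  suff -> : eval_field P x = 0 by rewrite mem0v.
  by apply/rowP => i; rewrite mxE Pc c0.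
have c0 : c != 0.
  by rewrite (cE _ p0s) scaler_eq0 negb_or lam0 //= rep_neq0.
have cp p : p \in s -> c \in val p by move=> ps; rewrite (cE _ ps) memvZ ?mem_rep.
have sE : perm_eq s [:: p0].
  apply: uniq_perm => // p; rewrite inE; apply/idP/eqP => [ps|-> //].
  exact: P2_eq c0 (cp _ ps) (cp _ p0s).
rewrite (perm_big _ sE) big_seq1 /baum_bott lin mxtrace_scalar det_scalar add0r.
by move: (multiplier P p0) (lam0 _ p0s) => l l0; field.
Qed.

(** P is a linear map A.  Nondegeneracy forces its eigenvalues a, b, c to be
    distinct, the singular points are its three eigenlines, and the linearization
    at the eigenline of a has eigenvalues b - a and c - a.  What remains is
    a Lagrange interpolation identity. *)
Lemma sum_baum_bott_deg1 (R : realType) (P : 'I_3 -> {mpoly R[i][3]})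
    (s : seq (P2 R)) :
  (forall j, P j \is 1.-homog) -> uniq s -> (forall p, p \in s <-> Sing P p) ->
  (forall p, p \in s -> nondegenerate_at P p) ->
  \sum_(p <- s) baum_bott P p = (1%:R + 2) ^+ 2.
Proof.
move=> Pd us sS nd; pose A := jacobian P 0.
have JA v : jacobian P v = A.
  apply/matrixP => j k; rewrite [LHS]mxE [RHS]mxE.
  by rewrite (homog0E (mderiv_homog k (Pd j))) !mevalC.
have PA (v : 'rV[R[i]]_3) i : (P i).@[v 0] = \sum_j A i j * v 0 j.
  rewrite -[P i]scale1r -(euler_identity (Pd i)) meval_sum.
  by apply: eq_bigr => j _; rewrite -(JA v) mevalM mevalXU mxE.
have [a [b [c HA]]] := det_sub_scalar_split A.
(* D l is the second symmetric function of a - l, b - l, c - l; when l is one of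
   a, b, c it is the product of the other two differences. *)
pose D l := (a - l) * (b - l) + (b - l) * (c - l) + (c - l) * (a - l).
have spec p : p \in s -> let l := multiplier P p in
    [/\ (a - l) * (b - l) * (c - l) = 0, \tr (lin_at P p) = a + b + c - 3 * l &
        \det (lin_at P p) = D l].
  move=> ps l; have [_] := lin_at_spec Pd ((sS p).1 ps).
  rewrite JA -/l mul1r => H.
  have {}H t : (a - t) * (b - t) * (c - t) =
      (l - t) * ((l - t) ^+ 2 + (l - t) * \tr (lin_at P p) + \det (lin_at P p)).
    by rewrite -det2_shift -HA H.
  (* The values of the characteristic polynomial at these three points determine the
     trace and the determinant of the linearization. *)
  have H0 := H l; have H1 := H (l - 1); have H2 := H (l + 1).
  move: H0 H1 H2; rewrite /D; move: (\tr _) (\det _) => T E; clear.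
  have -> : l - (l - 1) = 1 by ring.
  have -> : l - (l + 1) = -1 by ring.
  rewrite subrr mul0r => H0 H1 H2.
  have two : (2 : R[i]) != 0 by rewrite pnatr_eq0.
  split => //; apply: (mulfI two).
    transitivity (((a - (l - 1)) * (b - (l - 1)) * (c - (l - 1)) +
      (a - (l + 1)) * (b - (l + 1)) * (c - (l + 1)))
      - 2 * ((a - l) * (b - l) * (c - l))); last by ring.
    by rewrite H0 H1 H2; ring.
  transitivity (((a - (l - 1)) * (b - (l - 1)) * (c - (l - 1)) -
      (a - (l + 1)) * (b - (l + 1)) * (c - (l + 1))) - 2); last by ring.
  by rewrite H1 H2; ring.
have D0 p : p \in s -> D (multiplier P p) != 0.
  by move=> ps; have [_ _ <-] := spec p ps; have := nd p ps; rewrite /nondegenerate_at unitmxE unitfE.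
have eig l : (a - l) * (b - l) * (c - l) = 0 -> exists2 p, p \in s & multiplier P p = l.
  rewrite -HA => /det0_eigenvector[v v0 vA].
  have Pv i : (P i).@[v 0] = l * v 0 i by rewrite PA vA.
  have [p vp] := exists_line v0.
  have [d' [pS d0 _ E]] := Sing_line Pd vp v0 Pv.
  exists p; first exact/sS.
  by apply: (mulfI d0); rewrite -[d' in LHS]expr1 E mulrC.
have inj : {in s &, injective (multiplier P)}.
  move=> p q ps qs lpq; set l := multiplier P p in lpq.
  have Hp : forall i, \sum_j A i j * rep p 0 j = l * rep p 0 i.
    by move=> i; rewrite -PA; have /(SingE _ Pd) -> := (sS p).1 ps.
  have Hq : forall i, \sum_j A i j * rep q 0 j = l * rep q 0 i.
    by move=> i; rewrite -PA lpq; have /(SingE _ Pd) -> := (sS q).1 qs.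
  have := nd p ps; rewrite /nondegenerate_at lin_atE JA => U.
  apply: (P2_eq (rep_neq0 q)); last exact: mem_rep.
  by rewrite (eigenvector_unique (rep_chart p) Hp Hq U) memvZ ?mem_rep.
have [[pa pas Ea] [pb pbs Eb] [pc pcs Ec]] :
   [/\ exists2 p, p \in s & multiplier P p = a,
      exists2 p, p \in s & multiplier P p = b &
      exists2 p, p \in s & multiplier P p = c].
  by split; apply: eig; rewrite subrr ?mulr0 ?mul0r.
have ab : a != b.
  by have := D0 _ pas; rewrite Ea /D; apply: contraNneq => <-; apply/eqP; ring.
have bc : b != c.
  by have := D0 _ pbs; rewrite Eb /D; apply: contraNneq => <-; apply/eqP; ring.
have ac : a != c.
  by have := D0 _ pas; rewrite Ea /D; apply: contraNneq => <-; apply/eqP; ring.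
have sE : perm_eq [seq multiplier P p | p <- s] [:: a; b; c].
  apply: uniq_perm; first by rewrite map_inj_in_uniq.
    by rewrite /= !inE negb_or ab ac bc.
  move=> l; apply/mapP/idP => [[p ps ->]|].
    have [/eqP] := spec p ps; rewrite !mulf_eq0 !subr_eq0 !inE => H _ _.
    by rewrite ![multiplier P p == _]eq_sym orbA.
  by rewrite !inE => /or3P[] /eqP ->; [exists pa|exists pb|exists pc].
pose F l := (a + b + c - 3 * l) ^+ 2 / D l.
have -> : \sum_(p <- s) baum_bott P p = \sum_(l <- [seq multiplier P p | p <- s]) F l.
  rewrite big_map; apply: eq_big_seq => p ps.
  by rewrite /baum_bott /F; have [_ -> ->] := spec p ps.
rewrite (perm_big _ sE) !big_cons big_nil /= addr0 /F /D !subrr.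
rewrite !(mul0r, mulr0, add0r, addr0).
have ab0 : a - b != 0 by rewrite subr_eq0.
have bc0 : b - c != 0 by rewrite subr_eq0.
have ac0 : a - c != 0 by rewrite subr_eq0.
have ba0 : b - a != 0 by rewrite -opprB oppr_eq0.
have cb0 : c - b != 0 by rewrite -opprB oppr_eq0.
have ca0 : c - a != 0 by rewrite -opprB oppr_eq0.
by field; rewrite ab0 ac0 bc0 ba0 cb0 ca0.
Qed.

Unset Implicit Arguments.
Set Strict Implicit.

Theorem mainTheorem2 (R : realType) (d : nat) (F : foliation R d)
    (hF : forall p : P2 R, Sing F p -> nondegenerate_at F p) :
  \sum_(p \in Sing F) baum_bott F p = (d%:R + 2) ^+ 2 :> R[i].
Proof.
case: F hF => P Pd finS /= hF; rewrite (fsbig_finite _ _ finS) /=.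
set s : seq (P2 R) := finmap.enum_fset _.
have sS (p : P2 R) : p \in s <-> Sing P p.
  by have := in_fset_set finS p => /= ->; rewrite inE.
have nd p : p \in s -> nondegenerate_at P p by move=> /sS/hF.
have us : uniq s by exact: finmap.fset_uniq.
case: d Pd => [|[|e]] Pd.
- exact: sum_baum_bott_deg0.
- exact: sum_baum_bott_deg1.
exact: sum_baum_bott_ge2.
Qed.
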